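(* The first-order theory of $\mathsf{LA}_\rhd$ has a model completion.
   Context: Lattice-ordered abelian groups are regarded (via term equivalence) as pointed residuated lattices $\langle L,\wedge,\vee,\cdot,\backslash,/,\mathrm{e},0\rangle$ with $x\cdot y=x+y$, $x\backslash y=y-x$, $x/y=x-y$, and $\mathrm{e}=0=$ the group identity; $\mathsf{LA}$ denotes this variety. $\mathsf{LA}_\rhd$ is the variety, in the language $\{\wedge,\vee,\cdot,\backslash,/,\mathrm{e},0,\rhd\}$, generated by the linearly ordered members of $\mathsf{LA}$ (ordered abelian groups) expanded with the binary operation $x\rhd y:=y$ if $\mathrm{e}\le x$ and $x\rhd y:=\mathrm{e}$ otherwise. A model completion of a theory $T$ is a model complete theory with the same universal consequences as $T$ such that for every model $M$ of $T$, it together with the diagram of $M$ is complete. *)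

(* Defs.v *)
(* A deep embedding of first-order logic (with equality) in the
   signature {meet, join, mul, ldiv, rdiv, e, 0, tri} of LA_tri, extended by a
   type C of constant symbols (needed for diagrams). *)
From Stdlib Require Import PeanoNat.

Set Implicit Arguments.

Inductive term (C : Type) : Type :=
| tvar : nat -> term C
| tcst : C -> term C
| tmeet : term C -> term C -> term C
| tjoin : term C -> term C -> term C
| tmul : term C -> term C -> term C
| tldiv : term C -> term C -> term C
| trdiv : term C -> term C -> term C
| te : term C
| tzero : term C
| ttri : term C -> term C -> term C.

Arguments tvar {C}. Arguments te {C}. Arguments tzero {C}.

Inductive formula (C : Type) : Type :=
| fbot : formula C
| feq : term C -> term C -> formula C
| fimp : formula C -> formula C -> formula C
| fand : formula C -> formula C -> formula C
| for_ : formula C -> formula C -> formula C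
| fall : nat -> formula C -> formula C
| fex : nat -> formula C -> formula C.

Arguments fbot {C}.

Definition fnot (C : Type) (p : formula C) : formula C := fimp p fbot.

Fixpoint tfree (C : Type) (n : nat) (t : term C) : Prop :=
  match t with
  | tvar m => n = m
  | tcst _ | te | tzero => False
  | tmeet a b | tjoin a b | tmul a b | tldiv a b | trdiv a b | ttri a b =>
      tfree n a \/ tfree n b
  end.

Fixpoint ffree (C : Type) (n : nat) (p : formula C) : Prop :=
  match p with
  | fbot => False
  | feq s t => tfree n s \/ tfree n t
  | fimp a b | fand a b | for_ a b => ffree n a \/ ffree n b
  | fall m a | fex m a => n <> m /\ ffree n a
  end.

Definition sentence (C : Type) (p : formula C) : Prop := forall n, ~ ffree n p.

Fixpoint qfree (C : Type) (p : formula C) : Prop :=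
  match p with
  | fbot | feq _ _ => True
  | fimp a b | fand a b | for_ a b => qfree a /\ qfree b
  | fall _ _ | fex _ _ => False
  end.

Inductive universal (C : Type) : formula C -> Prop :=
| univ_qf : forall p, qfree p -> universal p
| univ_all : forall n p, universal p -> universal (fall n p).

Definition literal (C : Type) (p : formula C) : Prop :=
  (exists s t, p = feq s t) \/ (exists s t, p = fnot (feq s t)).

Fixpoint map_term (C D : Type) (f : C -> D) (t : term C) : term D :=
  match t with
  | tvar n => tvar n
  | tcst c => tcst (f c)
  | tmeet a b => tmeet (map_term f a) (map_term f b)
  | tjoin a b => tjoin (map_term f a) (map_term f b)
  | tmul a b => tmul (map_term f a) (map_term f b)
  | tldiv a b => tldiv (map_term f a) (map_term f b)
  | trdiv a b => trdiv (map_term f a) (map_term f b)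
  | te => te
  | tzero => tzero
  | ttri a b => ttri (map_term f a) (map_term f b)
  end.

Fixpoint map_formula (C D : Type) (f : C -> D) (p : formula C) : formula D :=
  match p with
  | fbot => fbot
  | feq s t => feq (map_term f s) (map_term f t)
  | fimp a b => fimp (map_formula f a) (map_formula f b)
  | fand a b => fand (map_formula f a) (map_formula f b)
  | for_ a b => for_ (map_formula f a) (map_formula f b)
  | fall n a => fall n (map_formula f a)
  | fex n a => fex n (map_formula f a)
  end.

Record structure (C : Type) : Type := Structure {
  car :> Type;
  s_meet : car -> car -> car;
  s_join : car -> car -> car;
  s_mul : car -> car -> car;
  s_ldiv : car -> car -> car;
  s_rdiv : car -> car -> car;
  s_e : car;
  s_zero : car;
  s_tri : car -> car -> car;
  s_cst : C -> car
}.

Fixpoint eval (C : Type) (S : structure C) (rho : nat -> car S) (t : term C)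
  : car S :=
  match t with
  | tvar n => rho n
  | tcst c => s_cst S c
  | tmeet a b => s_meet S (eval S rho a) (eval S rho b)
  | tjoin a b => s_join S (eval S rho a) (eval S rho b)
  | tmul a b => s_mul S (eval S rho a) (eval S rho b)
  | tldiv a b => s_ldiv S (eval S rho a) (eval S rho b)
  | trdiv a b => s_rdiv S (eval S rho a) (eval S rho b)
  | te => s_e S
  | tzero => s_zero S
  | ttri a b => s_tri S (eval S rho a) (eval S rho b)
  end.

Definition upd (A : Type) (rho : nat -> A) (n : nat) (a : A) : nat -> A :=
  fun m => if Nat.eqb m n then a else rho m.

Fixpoint sat (C : Type) (S : structure C) (rho : nat -> car S) (p : formula C)
  : Prop :=
  match p with
  | fbot => False
  | feq s t => eval S rho s = eval S rho t
  | fimp a b => sat S rho a -> sat S rho b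
  | fand a b => sat S rho a /\ sat S rho b
  | for_ a b => sat S rho a \/ sat S rho b
  | fall n a => forall x : car S, sat S (upd rho n x) a
  | fex n a => exists x : car S, sat S (upd rho n x) a
  end.

(* A theory is a set of formulas (we only use sets of sentences). *)
Definition theory (C : Type) := formula C -> Prop.

Definition models (C : Type) (T : theory C) (S : structure C) : Prop :=
  forall p, T p -> forall rho, sat S rho p.

Definition entails (C : Type) (T : theory C) (p : formula C) : Prop :=
  forall S : structure C, models T S -> forall rho, sat S rho p.

Definition complete (C : Type) (T : theory C) : Prop :=
  (exists S : structure C, models T S) /\
  forall p, sentence p -> entails T p \/ entails T (fnot p).

Definition L0 := Empty_set.
Definition str0 := structure L0.

Definition lift_theory (D : Type) (T : theory L0) : theory D :=
  fun q => exists p, T p /\ q = map_formula (fun c : L0 => match c with end) p.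

Definition union (C : Type) (T U : theory C) : theory C := fun p => T p \/ U p.

Definition expand (M : str0) : structure (car M) :=
  @Structure (car M) (car M) (s_meet M) (s_join M) (s_mul M) (s_ldiv M)
    (s_rdiv M) (s_e M) (s_zero M) (s_tri M) (fun a => a).

Definition diagram (M : str0) : theory (car M) :=
  fun p => sentence p /\ literal p /\ forall rho, sat (expand M) rho p.

Definition embedding {M N : str0} (h : car M -> car N) : Prop :=
  (forall x y, h x = h y -> x = y) /\
  (forall x y, h (s_meet M x y) = s_meet N (h x) (h y)) /\
  (forall x y, h (s_join M x y) = s_join N (h x) (h y)) /\
  (forall x y, h (s_mul M x y) = s_mul N (h x) (h y)) /\
  (forall x y, h (s_ldiv M x y) = s_ldiv N (h x) (h y)) /\
  (forall x y, h (s_rdiv M x y) = s_rdiv N (h x) (h y)) /\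
  h (s_e M) = s_e N /\ h (s_zero M) = s_zero N /\
  (forall x y, h (s_tri M x y) = s_tri N (h x) (h y)).

Definition elementary {M N : str0} (h : car M -> car N) : Prop :=
  forall (p : formula L0) (rho : nat -> car M),
    sat M rho p <-> sat N (fun n => h (rho n)) p.

Definition model_complete (T : theory L0) : Prop :=
  forall (M N : str0) (h : car M -> car N),
    models T M -> models T N -> embedding h -> elementary h.

Definition model_completion (T' T : theory L0) : Prop :=
  (forall p, T' p -> sentence p) /\
  model_complete T' /\
  (forall p, sentence p -> universal p -> (entails T p <-> entails T' p)) /\
  (forall M : str0, models T M -> complete (union (@lift_theory (car M) T') (diagram M))).

Definition has_model_completion (T : theory L0) : Prop :=
  exists T' : theory L0, model_completion T' T.

(* S is (term equivalent to) an ordered abelian group expanded with |> :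
   there are an inverse and a total translation-invariant order such that
   mul = +, e = 0 = group identity, x\y = y - x, x/y = x - y, meet = min,
   join = max, and x |> y = y if e <= x, and e otherwise. *)
Definition linear_LAtri (S : str0) : Prop :=
  exists (inv : car S -> car S) (le : car S -> car S -> Prop),
    (forall x y z, s_mul S x (s_mul S y z) = s_mul S (s_mul S x y) z) /\
    (forall x y, s_mul S x y = s_mul S y x) /\
    (forall x, s_mul S x (s_e S) = x) /\
    (forall x, s_mul S x (inv x) = s_e S) /\
    (forall x, le x x) /\
    (forall x y, le x y -> le y x -> x = y) /\
    (forall x y z, le x y -> le y z -> le x z) /\
    (forall x y, le x y \/ le y x) /\
    (forall x y z, le x y -> le (s_mul S x z) (s_mul S y z)) /\
    (forall x y, le x y -> s_meet S x y = x /\ s_join S x y = y) /\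
    (forall x y, le y x -> s_meet S x y = y /\ s_join S x y = x) /\
    (forall x y, s_ldiv S x y = s_mul S y (inv x)) /\
    (forall x y, s_rdiv S x y = s_mul S x (inv y)) /\
    s_zero S = s_e S /\
    (forall x y, le (s_e S) x -> s_tri S x y = y) /\
    (forall x y, ~ le (s_e S) x -> s_tri S x y = s_e S).

(* membership in the variety generated by the linearly ordered members:
   S satisfies every equation valid in all of them (Birkhoff: = HSP) *)
Definition in_LAtri (S : str0) : Prop :=
  forall s t : term L0,
    (forall K : str0, linear_LAtri K -> forall rho, eval K rho s = eval K rho t) ->
    forall rho, eval S rho s = eval S rho t.

Definition Th_LAtri : theory L0 :=
  fun p => sentence p /\ forall S : str0, in_LAtri S -> forall rho, sat S rho p.

(* Main.v *)
(* The model completion is the theory of the following algebras.  Given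
   nontrivial divisible ordered abelian groups D_i (i in a nonempty set I), take
   the functions f assigning to (n, i), n a natural number, an element f n i of
   D_i, with f periodic in n and f 0 = 0.

   Quantifier elimination.  Terms are evaluated pointwise, and a quantifier-free
   condition on x and the parameters is a disjunction of systems of equations
   and disequations.  Such a system has a solution x iff its equations are
   solvable at every point and, for each disequation, some point admits a local
   solution of the equations and this disequation: periodicity allows the
   finitely many distinguished points to be moved apart, and everything vanishes
   at n = 0.  Solvability at a point is quantifier-free by Fourier-Motzkin
   elimination for divisible ordered groups, and "some point satisfies d" is
   again a quantifier-free condition: it always holds if d is true at the zero
   assignment, and otherwise |> turns d into a term which is nontrivial exactly
   where d holds.

   Embedding.  For x in an algebra M of the variety, z |-> x |> z and
   z |-> z - (x |> z) are commuting endomorphisms, because each is the identity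
   or trivial in every linearly ordered algebra.  For a <> e, a maximal set of
   them whose finite composites do not annihilate a determines a linearly
   ordered quotient of M in which a survives; pass to divisible hulls. *)
From Stdlib Require Import ZArith Lia List Classical ClassicalEpsilon
  FunctionalExtensionality PropExtensionality.
From mathcomp Require classical_sets.
Require Import Defs.
Import ListNotations.

Set Implicit Arguments.

(** * Substitution and closure of formulas *)

Lemma eval_ext (C : Type) (S : structure C) (rho rho' : nat -> S) (t : term C) :
  (forall n, tfree n t -> rho n = rho' n) -> eval S rho t = eval S rho' t.
Proof.
  induction t; simpl; intros H; auto;
    rewrite IHt1, IHt2; auto.
Qed.

Lemma upd_same (A : Type) (rho : nat -> A) n a : upd rho n a n = a.
Proof. unfold upd. now rewrite Nat.eqb_refl. Qed.

Lemma upd_other (A : Type) (rho : nat -> A) n m a : m <> n -> upd rho n a m = rho m.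
Proof. unfold upd. intros H. now apply Nat.eqb_neq in H as ->. Qed.

Lemma upd_map (A B : Type) (h : A -> B) (rho : nat -> A) n a :
  (fun m => h (upd rho n a m)) = upd (fun m => h (rho m)) n (h a).
Proof.
  apply functional_extensionality. intros m. unfold upd.
  now destruct (Nat.eqb m n).
Qed.

Lemma upd_id (A : Type) (rho : nat -> A) n : upd rho n (rho n) = rho.
Proof.
  apply functional_extensionality. intros m. unfold upd.
  destruct (Nat.eqb_spec m n); congruence.
Qed.

Lemma sat_ext (C : Type) (S : structure C) (p : formula C) :
  forall rho rho' : nat -> S,
    (forall n, ffree n p -> rho n = rho' n) -> (sat S rho p <-> sat S rho' p).
Proof.
  induction p; simpl; intros rho rho' H.
  - tauto.
  - rewrite (eval_ext S rho rho' t), (eval_ext S rho rho' t0) by auto. tauto.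
  - rewrite (IHp1 rho rho'), (IHp2 rho rho') by auto. tauto.
  - rewrite (IHp1 rho rho'), (IHp2 rho rho') by auto. tauto.
  - rewrite (IHp1 rho rho'), (IHp2 rho rho') by auto. tauto.
  - assert (E : forall x, sat S (upd rho n x) p <-> sat S (upd rho' n x) p).
    { intros x. apply IHp. intros m Hm. unfold upd.
      destruct (Nat.eqb_spec m n); auto. }
    split; intros K x; apply E, K.
  - assert (E : forall x, sat S (upd rho n x) p <-> sat S (upd rho' n x) p).
    { intros x. apply IHp. intros m Hm. unfold upd.
      destruct (Nat.eqb_spec m n); auto. }
    split; intros [x K]; exists x; apply E, K.
Qed.

Lemma tfree_bounded (C : Type) (t : term C) : exists N, forall n, tfree n t -> n < N.
Proof.
  induction t; simpl;
    try (destruct IHt1 as [N1 H1], IHt2 as [N2 H2]; exists (N1 + N2);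
         intros n [K|K]; [apply H1 in K | apply H2 in K]; lia);
    try (exists 0; tauto).
  exists (S n). intros; lia.
Qed.

Lemma ffree_bounded (C : Type) (p : formula C) : exists N, forall n, ffree n p -> n < N.
Proof.
  induction p; simpl;
    try (destruct IHp1 as [N1 H1], IHp2 as [N2 H2]; exists (N1 + N2);
         intros n [K|K]; [apply H1 in K | apply H2 in K]; lia).
  - exists 0; tauto.
  - destruct (tfree_bounded t) as [N1 H1], (tfree_bounded t0) as [N2 H2].
    exists (N1 + N2). intros n [K|K]; [apply H1 in K | apply H2 in K]; lia.
  - destruct IHp as [N H]. exists N. intros m [_ K]; auto.
  - destruct IHp as [N H]. exists N. intros m [_ K]; auto.
Qed.

Fixpoint close (C : Type) (N : nat) (p : formula C) : formula C :=
  match N with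
  | 0 => p
  | S n => fall n (close n p)
  end.

Lemma ffree_close (C : Type) N (p : formula C) n :
  ffree n (close N p) -> N <= n /\ ffree n p.
Proof.
  induction N as [|N IH]; simpl; [split; [lia|auto]|].
  intros [H1 H2]. destruct (IH H2). split; [lia|auto].
Qed.

Lemma sat_close (C : Type) (S : structure C) N (p : formula C) :
  (forall rho, sat S rho (close N p)) <-> (forall rho, sat S rho p).
Proof.
  induction N as [|N IH]; simpl; [tauto|]. rewrite <- IH. split.
  - intros H rho. rewrite <- (upd_id rho N). apply H.
  - intros H rho x. apply H.
Qed.

(** Theories consist of sentences, whereas identities and eliminated equivalences are open formulas.
    Truth under all assignments is unchanged by quantifying universally over every variable below a
    bound on the free ones. *)
Lemma closed_form (C : Type) (p : formula C) :
  exists q, sentence q /\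
    forall S : structure C, (forall rho, sat S rho q) <-> (forall rho, sat S rho p).
Proof.
  destruct (ffree_bounded p) as [N HN]. exists (close N p). split.
  - intros n Hn. apply ffree_close in Hn as [H1 H2]. apply HN in H2. lia.
  - intros S. apply sat_close.
Qed.

(** * Ordered abelian groups *)

Record oag := OAG {
  oc :> Type;
  oadd : oc -> oc -> oc;
  oopp : oc -> oc;
  ozero : oc;
  ole : oc -> oc -> Prop;
  oaddA : forall x y z, oadd x (oadd y z) = oadd (oadd x y) z;
  oaddC : forall x y, oadd x y = oadd y x;
  oadd0 : forall x, oadd x ozero = x;
  oaddN : forall x, oadd x (oopp x) = ozero;
  ole_antisym : forall x y, ole x y -> ole y x -> x = y;
  ole_trans : forall x y z, ole x y -> ole y z -> ole x z;
  ole_total : forall x y, ole x y \/ ole y x;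
  ole_add : forall x y z, ole x y -> ole (oadd x z) (oadd y z)
}.

Arguments oadd {o}. Arguments oopp {o}. Arguments ozero {o}. Arguments ole {o}.
Arguments oaddA {o}. Arguments oaddC {o}. Arguments oadd0 {o}. Arguments oaddN {o}.
Arguments ole_antisym {o}. Arguments ole_trans {o}. Arguments ole_total {o}.
Arguments ole_add {o}.

Declare Scope oag_scope.
Delimit Scope oag_scope with G.
Infix "+" := oadd : oag_scope.
Notation "- x" := (oopp x) : oag_scope.
Notation "x - y" := (oadd x (oopp y)) : oag_scope.
Infix "<=" := ole : oag_scope.
Notation "0" := ozero : oag_scope.
Local Open Scope oag_scope.

Lemma oadd0l {D : oag} (x : D) : 0 + x = x.
Proof. now rewrite oaddC, oadd0. Qed.

Lemma oadd_cancel {D : oag} (x y z : D) : x + z = y + z -> x = y.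
Proof.
  intros H. rewrite <- (oadd0 x), <- (oadd0 y), <- (oaddN z), !oaddA.
  now rewrite H.
Qed.

Lemma oaddACA {D : oag} (x y z t : D) : (x + y) + (z + t) = (x + z) + (y + t).
Proof.
  rewrite <- !oaddA. f_equal. rewrite !oaddA. f_equal. apply oaddC.
Qed.

Lemma oopp_add {D : oag} (x y : D) : - (x + y) = - x + - y.
Proof.
  apply oadd_cancel with (z := x + y).
  rewrite (oaddC _ (x + y)), oaddN, oaddACA.
  now rewrite (oaddC (- x)), (oaddC (- y)), !oaddN, oadd0.
Qed.

Lemma oopp0 {D : oag} : - (ozero (o := D)) = 0.
Proof. rewrite <- (oadd0l (- _)). apply oaddN. Qed.

(** * Integer multiples in abelian groups *)

Fixpoint nmul {D : oag} (n : nat) (x : D) : D :=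
  match n with O => 0 | S n => x + nmul n x end.

Definition zmul {D : oag} (k : Z) (x : D) : D :=
  match k with
  | Z0 => 0
  | Zpos p => nmul (Pos.to_nat p) x
  | Zneg p => - nmul (Pos.to_nat p) x
  end.

Lemma nmul_add {D : oag} n m (x : D) : nmul (n + m)%nat x = nmul n x + nmul m x.
Proof.
  induction n as [|n IH]; simpl; [now rewrite oadd0l|]. now rewrite IH, oaddA.
Qed.

(** Writing an integer as a difference of naturals reduces the laws of [zmul] to those of [nmul],
    without a case distinction on signs. *)
Lemma zmul_diff {D : oag} n m (x : D) :
  zmul (Z.of_nat n - Z.of_nat m) x = nmul n x - nmul m x.
Proof.
  destruct (Z.of_nat n - Z.of_nat m)%Z as [|p|p] eqn:E; simpl.
  - assert (n = m) as -> by lia. now rewrite oaddN.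
  - assert (n = Pos.to_nat p + m)%nat as -> by lia.
    now rewrite nmul_add, <- oaddA, oaddN, oadd0.
  - assert (m = Pos.to_nat p + n)%nat as -> by lia.
    rewrite nmul_add, oopp_add, (oaddC (- _) (- nmul n x)), oaddA, oaddN.
    now rewrite oadd0l.
Qed.

Lemma Z_diff (k : Z) : exists n m, k = (Z.of_nat n - Z.of_nat m)%Z.
Proof. exists (Z.to_nat k), (Z.to_nat (- k)). lia. Qed.

Lemma zmul_add_l {D : oag} k l (x : D) : zmul (k + l) x = zmul k x + zmul l x.
Proof.
  destruct (Z_diff k) as (a & b & ->), (Z_diff l) as (c & d & ->).
  replace (Z.of_nat a - Z.of_nat b + (Z.of_nat c - Z.of_nat d))%Z
    with (Z.of_nat (a + c) - Z.of_nat (b + d))%Z by lia.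
  rewrite !zmul_diff, !nmul_add, oopp_add. apply oaddACA.
Qed.

Lemma zmul_opp_l {D : oag} k (x : D) : zmul (- k) x = - zmul k x.
Proof.
  apply oadd_cancel with (z := zmul k x).
  rewrite <- zmul_add_l, oaddC, oaddN. now replace (- k + k)%Z with 0%Z by lia.
Qed.

Lemma nmul_add_r {D : oag} n (x y : D) : nmul n (x + y) = nmul n x + nmul n y.
Proof.
  induction n as [|n IH]; simpl; [now rewrite oadd0|]. rewrite IH. apply oaddACA.
Qed.

Lemma zmul_add_r {D : oag} k (x y : D) : zmul k (x + y) = zmul k x + zmul k y.
Proof.
  destruct (Z_diff k) as (a & b & ->).
  rewrite !zmul_diff, !nmul_add_r, oopp_add. apply oaddACA.
Qed.

Lemma zmul0 {D : oag} k : zmul k (ozero (o := D)) = 0.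
Proof.
  apply oadd_cancel with (z := zmul k 0). now rewrite <- zmul_add_r, oadd0, oadd0l.
Qed.

Lemma zmul_opp_r {D : oag} k (x : D) : zmul k (- x) = - zmul k x.
Proof.
  apply oadd_cancel with (z := zmul k x).
  rewrite <- zmul_add_r. now rewrite !(oaddC (- _)), !oaddN, zmul0.
Qed.

Lemma zmul_1 {D : oag} (x : D) : zmul 1 x = x.
Proof. simpl. apply oadd0. Qed.

Lemma zmul_mul {D : oag} k l (x : D) : zmul k (zmul l x) = zmul (k * l) x.
Proof.
  assert (H : forall n, zmul (Z.of_nat n) (zmul l x) = zmul (Z.of_nat n * l) x).
  { induction n as [|n IH]; [reflexivity|].
    replace (Z.of_nat (S n)) with (Z.of_nat n + 1)%Z by lia.
    rewrite zmul_add_l, IH, zmul_1.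
    replace ((Z.of_nat n + 1) * l)%Z with (Z.of_nat n * l + l)%Z by ring.
    now rewrite zmul_add_l. }
  destruct (Z_diff k) as (a & b & ->).
  rewrite <- Z.add_opp_r, zmul_add_l, zmul_opp_l, !H.
  rewrite <- zmul_opp_l, <- zmul_add_l. f_equal. ring.
Qed.

Lemma zmul_nat {D : oag} n (x : D) : zmul (Z.of_nat n) x = nmul n x.
Proof.
  rewrite <- (Z.sub_0_r (Z.of_nat n)). change 0%Z with (Z.of_nat 0).
  rewrite zmul_diff. simpl. now rewrite oopp0, oadd0.
Qed.

(* Reflective normalisation in abelian groups: an expression is determined by
   its integer coefficients. *)
Inductive gexp : Type :=
| GV : nat -> gexp
| G0 : gexp
| GA : gexp -> gexp -> gexp
| GN : gexp -> gexp
| GZ : Z -> gexp -> gexp.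

Fixpoint gval {D : oag} (env : list D) (e : gexp) : D :=
  match e with
  | GV n => nth n env 0
  | G0 => 0
  | GA a b => gval env a + gval env b
  | GN a => - gval env a
  | GZ k a => zmul k (gval env a)
  end.

Fixpoint gcoef (e : gexp) (n : nat) : Z :=
  match e with
  | GV m => if Nat.eqb m n then 1 else 0
  | G0 => 0
  | GA a b => gcoef a n + gcoef b n
  | GN a => - gcoef a n
  | GZ k a => k * gcoef a n
  end.

Fixpoint gsum {D : oag} (env : list D) (c : nat -> Z) : D :=
  match env with
  | [] => 0
  | x :: env => zmul (c 0%nat) x + gsum env (fun n => c (S n))
  end.

Lemma gsum_0 {D : oag} (env : list D) : gsum env (fun _ => 0%Z) = 0.
Proof. induction env as [|x env IH]; simpl; [|rewrite IH, oadd0]; reflexivity. Qed.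

Lemma gsum_add {D : oag} (env : list D) : forall c d,
  gsum env (fun n => (c n + d n)%Z) = gsum env c + gsum env d.
Proof.
  induction env as [|x env IH]; intros c d; simpl; [now rewrite oadd0|].
  rewrite IH, zmul_add_l. apply oaddACA.
Qed.

Lemma gsum_mul {D : oag} (env : list D) k : forall c,
  gsum env (fun n => (k * c n)%Z) = zmul k (gsum env c).
Proof.
  induction env as [|x env IH]; intros c; simpl; [now rewrite zmul0|].
  now rewrite IH, zmul_add_r, zmul_mul.
Qed.

Lemma gsum_var {D : oag} (env : list D) : forall m,
  gsum env (fun n => if Nat.eqb m n then 1%Z else 0%Z) = nth m env 0.
Proof.
  induction env as [|x env IH]; intros [|m]; cbn [gsum nth Nat.eqb]; auto.
  - now rewrite gsum_0, zmul_1, oadd0.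
  - rewrite IH. apply oadd0l.
Qed.

Lemma gval_gsum {D : oag} (env : list D) e : gval env e = gsum env (gcoef e).
Proof.
  induction e; cbn [gval gcoef].
  - now rewrite <- gsum_var.
  - now rewrite gsum_0.
  - now rewrite gsum_add, IHe1, IHe2.
  - transitivity (gsum env (fun n => (-1 * gcoef e n)%Z)).
    + rewrite gsum_mul, <- IHe. change (-1)%Z with (- (1))%Z.
      now rewrite zmul_opp_l, zmul_1.
    + reflexivity.
  - now rewrite gsum_mul, IHe.
Qed.

Fixpoint same_coef (n : nat) (a b : gexp) : Prop :=
  match n with
  | O => True
  | S n => gcoef a n = gcoef b n /\ same_coef n a b
  end.

Lemma same_coef_lt n a b : same_coef n a b ->
  forall m, (m < n)%nat -> gcoef a m = gcoef b m.
Proof.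
  induction n as [|n IH]; simpl; intros H m Hm; [lia|].
  destruct (Nat.eq_dec m n) as [->|]; [tauto|]. apply IH; [tauto|lia].
Qed.

Lemma gsum_ext {D : oag} (env : list D) : forall c d,
  (forall m, (m < length env)%nat -> c m = d m) -> gsum env c = gsum env d.
Proof.
  induction env as [|x env IH]; intros c d H; simpl in *; [reflexivity|].
  rewrite (H 0%nat) by lia. f_equal. apply IH. intros m Hm. apply H. lia.
Qed.

Lemma grp_reflect {D : oag} (env : list D) a b :
  same_coef (length env) a b -> gval env a = gval env b.
Proof.
  intros H. rewrite !gval_gsum. apply gsum_ext. now apply same_coef_lt.
Qed.

Ltac grp_mem x l :=
  match l with
  | @nil _ => constr:(false)
  | @cons _ x _ => constr:(true)
  | @cons _ _ ?l' => grp_mem x l'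
  end.
Ltac grp_env e l :=
  match e with
  | oadd ?a ?b => let l' := grp_env a l in grp_env b l'
  | oopp ?a => grp_env a l
  | zmul _ ?a => grp_env a l
  | ozero => l
  | _ => let m := grp_mem e l in
         match m with true => l | false => constr:(cons e l) end
  end.
Ltac grp_idx x l :=
  match l with
  | @cons _ x _ => constr:(O)
  | @cons _ _ ?l' => let n := grp_idx x l' in constr:(S n)
  end.
Ltac grp_reify e l :=
  match e with
  | oadd ?a ?b => let x := grp_reify a l in let y := grp_reify b l in constr:(GA x y)
  | oopp ?a => let x := grp_reify a l in constr:(GN x)
  | zmul ?k ?a => let x := grp_reify a l in constr:(GZ k x)
  | ozero => constr:(G0)
  | _ => let n := grp_idx e l in constr:(GV n)
  end.
(** The goal becomes one integer identity per atom, left to [ring]; the scalars of [zmul] may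
    therefore be variables. *)
Ltac grp :=
  match goal with
  | |- @eq ?T ?a ?b =>
    let l := grp_env a (@nil T) in
    let l := grp_env b l in
    let x := grp_reify a l in
    let y := grp_reify b l in
    refine (@grp_reflect _ l x y _);
    cbn [length same_coef gcoef Nat.eqb]; repeat split; ring
  end.

(** * Sign conditions and divisibility *)

Lemma ole_refl {D : oag} (x : D) : x <= x.
Proof. now destruct (ole_total x x). Qed.

Lemma ole_sub {D : oag} (x y : D) : 0 <= y - x <-> x <= y.
Proof.
  split; intros H.
  - apply (ole_add _ _ x) in H. rewrite oadd0l in H.
    replace (y - x + x) with y in H by grp. exact H.
  - apply (ole_add _ _ (- x)) in H. now rewrite oaddN in H.
Qed.

(** The boolean records strictness: by totality [pos true] is strict positivity, while [pos false]
    is nonnegativity. *)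
Definition pos {D : oag} (b : bool) (a : D) : Prop :=
  if b then ~ a <= 0 else 0 <= a.

Lemma pos_false {D : oag} b (a : D) : pos b a -> 0 <= a.
Proof. destruct b; simpl; intros H; [|exact H]. destruct (ole_total 0 a); tauto. Qed.

Lemma ole_add_nonneg {D : oag} (x y : D) : 0 <= x -> y <= x + y.
Proof. intros H. apply (ole_add _ _ y) in H. now rewrite oadd0l in H. Qed.

Lemma pos_mono {D : oag} b (x y : D) : x <= y -> pos b x -> pos b y.
Proof.
  destruct b; simpl; intros H K.
  - intros K'. apply K. now apply ole_trans with y.
  - now apply ole_trans with x.
Qed.

Lemma pos_add {D : oag} b c (x y : D) : pos b x -> pos c y -> pos (b || c) (x + y).
Proof.
  intros Hx Hy. destruct b; simpl.
  - apply pos_false in Hy. apply (@pos_mono _ true x); [|exact Hx].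
    rewrite oaddC. now apply ole_add_nonneg.
  - apply pos_false in Hx. apply pos_mono with y; [|exact Hy].
    now apply ole_add_nonneg.
Qed.

Lemma pos_orb {D : oag} b c (x : D) : pos (b || c) x -> pos b x /\ pos c x.
Proof.
  intros H. pose proof (pos_false _ _ H). destruct b, c; simpl in *; tauto.
Qed.

Lemma pos_opp {D : oag} (x : D) : pos true (- x) <-> ~ 0 <= x.
Proof.
  simpl.
  rewrite <- (ole_sub (- x) 0). replace (0 - - x) with x by grp. tauto.
Qed.

Lemma nmul_nonneg {D : oag} n (x : D) : 0 <= x -> 0 <= nmul n x.
Proof.
  intros H. induction n as [|n IH]; simpl; [apply ole_refl|].
  apply ole_trans with (nmul n x); [exact IH | now apply ole_add_nonneg].
Qed.

Lemma nmul_pos {D : oag} n b (x : D) : pos b x -> pos b (nmul (S n) x).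
Proof.
  intros H. simpl. apply pos_mono with x; [|exact H].
  rewrite oaddC. apply ole_add_nonneg, nmul_nonneg. now apply pos_false in H.
Qed.

(** Positive multiples preserve sign conditions. For the converse, the failure of a condition on [x]
    is a condition of the other strictness on the opposite of [x], to which the first direction
    applies. *)
Lemma pos_zmul {D : oag} k b (x : D) : (0 < k)%Z -> pos b (zmul k x) <-> pos b x.
Proof.
  intros Hk. assert (E : exists n, k = Z.of_nat (S n)).
  { exists (Z.to_nat (k - 1)). lia. }
  destruct E as [n ->]. clear Hk.
  assert (F : forall c (y : D), pos c y -> pos c (zmul (Z.of_nat (S n)) y)).
  { intros c y. rewrite zmul_nat. apply nmul_pos. }
  split; [|apply F]. destruct b; intros H.
  - intros K. apply H. rewrite <- ole_sub.
    replace (0 - zmul (Z.of_nat (S n)) x) with (zmul (Z.of_nat (S n)) (0 - x)) by grp.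
    apply (F false). now apply ole_sub.
  - apply NNPP. intros K. apply pos_opp in K. apply F in K.
    rewrite zmul_opp_r in K. now apply pos_opp in K.
Qed.

(** Nontriviality supplies a strictly positive element, with which strict inequalities can be
    satisfied. *)
Definition doag (D : oag) : Prop :=
  (exists x : D, x <> 0) /\ forall n (x : D), exists y, nmul (S n) y = x.

Lemma doag_pos {D : oag} : doag D -> exists c : D, pos true c.
Proof.
  intros [[x Hx] _]. destruct (classic (x <= 0)) as [H|H]; [|now exists x].
  exists (- x). apply pos_opp. intros K. now apply Hx, ole_antisym.
Qed.

Lemma doag_div {D : oag} k (x : D) : doag D -> k <> 0%Z -> exists y, zmul k y = x.
Proof.
  intros [_ H] Hk. assert (E : exists n, k = Z.of_nat (S n) \/ k = (- Z.of_nat (S n))%Z).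
  { exists (Z.abs_nat k - 1)%nat. lia. }
  destruct E as [n [-> | ->]].
  - destruct (H n x) as [y Hy]. exists y. now rewrite zmul_nat.
  - destruct (H n (- x)) as [y Hy]. exists y. rewrite zmul_opp_l, zmul_nat, Hy. grp.
Qed.

Definition ite (P : Prop) {A : Type} (x y : A) : A :=
  if excluded_middle_informative P then x else y.

Lemma ite_true (P : Prop) (A : Type) (x y : A) : P -> ite P x y = x.
Proof. unfold ite. now destruct (excluded_middle_informative P). Qed.

Lemma ite_false (P : Prop) (A : Type) (x y : A) : ~ P -> ite P x y = y.
Proof. unfold ite. now destruct (excluded_middle_informative P). Qed.

Definition lin_str (D : oag) : str0 :=
  @Structure L0 D
    (fun x y => ite (x <= y) x y) (fun x y => ite (x <= y) y x)
    oadd (fun x y => y - x) (fun x y => x - y) 0 0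
    (fun x y => ite (0 <= x) y 0) (fun c => match c with end).

(** * Quantifier elimination for divisible ordered abelian groups *)

(** The literals are a parameter because the notion serves twice: with linear inequalities in one
    ordered group, and with equations and disequations between sections. *)
Definition dnf {X Lit : Type} (holds : X -> Lit -> Prop) (P : X -> Prop) : Prop :=
  exists L : list (list Lit), forall x, P x <-> Exists (Forall (holds x)) L.

Lemma dnf_iff {X Lit} (holds : X -> Lit -> Prop) (P Q : X -> Prop) :
  (forall x, P x <-> Q x) -> dnf holds P -> dnf holds Q.
Proof. intros H [L HL]. exists L. intros x. rewrite <- H. apply HL. Qed.

Lemma dnf_false {X Lit} (holds : X -> Lit -> Prop) : dnf holds (fun _ => False).
Proof. exists []. intros x. now rewrite Exists_nil. Qed.

Lemma dnf_true {X Lit} (holds : X -> Lit -> Prop) : dnf holds (fun _ => True).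
Proof. exists [[]]. intros x. split; [|tauto]. intros _. now repeat constructor. Qed.

Lemma dnf_lit {X Lit} (holds : X -> Lit -> Prop) l : dnf holds (fun x => holds x l).
Proof.
  exists [[l]]. intros x. rewrite Exists_cons, Exists_nil, Forall_cons_iff.
  pose proof (Forall_nil (holds x)). tauto.
Qed.

Lemma dnf_or {X Lit} (holds : X -> Lit -> Prop) P Q :
  dnf holds P -> dnf holds Q -> dnf holds (fun x => P x \/ Q x).
Proof.
  intros [L HL] [M HM]. exists (L ++ M). intros x. now rewrite HL, HM, Exists_app.
Qed.

Lemma dnf_and {X Lit} (holds : X -> Lit -> Prop) P Q :
  dnf holds P -> dnf holds Q -> dnf holds (fun x => P x /\ Q x).
Proof.
  intros [L HL] [M HM]. exists (flat_map (fun l => map (app l) M) L). intros x.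
  rewrite HL, HM, !Exists_exists. setoid_rewrite in_flat_map.
  split.
  - intros [(l & Hl & Fl) (m & Hm & Fm)]. exists (l ++ m). rewrite Forall_app. split; auto.
    exists l. split; auto. apply in_map_iff. eauto.
  - intros (z & (l & Hl & Hz) & Fz). apply in_map_iff in Hz as (m & <- & Hm).
    apply Forall_app in Fz. split; [exists l | exists m]; tauto.
Qed.

Lemma dnf_exists {X Lit A} (holds : X -> Lit -> Prop) (L : list A) (P : A -> X -> Prop) :
  (forall a, In a L -> dnf holds (P a)) ->
  dnf holds (fun x => exists a, In a L /\ P a x).
Proof.
  induction L as [|a L IH]; simpl; intros H.
  - apply dnf_iff with (2 := dnf_false holds). firstorder.
  - apply dnf_iff with (P := fun x => P a x \/ exists a, In a L /\ P a x).
    + intros x. split; [intros [K|(b & K)] | intros (b & [<-|K] & K')]; eauto.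
      exists b; tauto.
    + apply dnf_or; auto.
Qed.

(** The formula and its negation are treated together, since an implication needs the normal form of
    its negated premise. *)
Lemma dnf_qfree {X Lit} (holds : X -> Lit -> Prop)
    (st : X -> str0) (en : forall x, nat -> st x) :
  (forall s t, dnf holds (fun x => eval (st x) (en x) s = eval (st x) (en x) t) /\
               dnf holds (fun x => eval (st x) (en x) s <> eval (st x) (en x) t)) ->
  forall p, qfree p -> dnf holds (fun x => sat (st x) (en x) p) /\
                       dnf holds (fun x => ~ sat (st x) (en x) p).
Proof.
  intros Hat p. induction p; simpl; intros Hp; try tauto.
  - split; [apply dnf_false|]. apply dnf_iff with (2 := dnf_true holds). tauto.
  - apply Hat.
  - destruct (IHp1 (proj1 Hp)) as [A1 B1], (IHp2 (proj2 Hp)) as [A2 B2]. split.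
    + apply dnf_iff with (2 := dnf_or B1 A2). intros x. tauto.
    + apply dnf_iff with (2 := dnf_and A1 B2). intros x. tauto.
  - destruct (IHp1 (proj1 Hp)) as [A1 B1], (IHp2 (proj2 Hp)) as [A2 B2]. split.
    + apply dnf_and; assumption.
    + apply dnf_iff with (2 := dnf_or B1 B2). intros x. tauto.
  - destruct (IHp1 (proj1 Hp)) as [A1 B1], (IHp2 (proj2 Hp)) as [A2 B2]. split.
    + apply dnf_or; assumption.
    + apply dnf_iff with (2 := dnf_and B1 B2). intros x. tauto.
Qed.

(** A single formula has to work in all worlds [w], although the structure varies with [w]. This
    uniformity later turns elimination in each structure into elimination modulo a theory. *)
Definition definable {W : Type} (st : W -> str0) (en : forall w, nat -> st w)
    (P : W -> Prop) : Prop :=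
  exists q, qfree q /\ forall w, P w <-> sat (st w) (en w) q.

Lemma definable_iff {W} (st : W -> str0) (en : forall w, nat -> st w) (P Q : W -> Prop) :
  (forall w, P w <-> Q w) -> definable st en P -> definable st en Q.
Proof. intros H (q & Hq & E). exists q. split; auto. intros w. now rewrite <- H. Qed.

Lemma definable_qf {W} (st : W -> str0) (en : forall w, nat -> st w) q :
  qfree q -> definable st en (fun w => sat (st w) (en w) q).
Proof. intros H. exists q. tauto. Qed.

Lemma definable_false {W} (st : W -> str0) (en : forall w, nat -> st w) :
  definable st en (fun _ => False).
Proof. exists fbot. simpl. tauto. Qed.

Lemma definable_imp {W} (st : W -> str0) (en : forall w, nat -> st w) P Q :
  definable st en P -> definable st en Q -> definable st en (fun w => P w -> Q w).
Proof.
  intros (p & Hp & Ep) (q & Hq & Eq). exists (fimp p q). simpl. split; auto.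
  intros w. now rewrite Ep, Eq.
Qed.

Lemma definable_and {W} (st : W -> str0) (en : forall w, nat -> st w) P Q :
  definable st en P -> definable st en Q -> definable st en (fun w => P w /\ Q w).
Proof.
  intros (p & Hp & Ep) (q & Hq & Eq). exists (fand p q). simpl. split; auto.
  intros w. now rewrite Ep, Eq.
Qed.

Lemma definable_or {W} (st : W -> str0) (en : forall w, nat -> st w) P Q :
  definable st en P -> definable st en Q -> definable st en (fun w => P w \/ Q w).
Proof.
  intros (p & Hp & Ep) (q & Hq & Eq). exists (for_ p q). simpl. split; auto.
  intros w. now rewrite Ep, Eq.
Qed.

Lemma definable_true {W} (st : W -> str0) (en : forall w, nat -> st w) :
  definable st en (fun _ => True).
Proof.
  apply definable_iff with (P := fun _ => False -> False); [tauto|].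
  apply definable_imp; apply definable_false.
Qed.

Lemma definable_forall {W A} (st : W -> str0) (en : forall w, nat -> st w)
    (L : list A) (P : A -> W -> Prop) :
  (forall a, In a L -> definable st en (P a)) ->
  definable st en (fun w => forall a, In a L -> P a w).
Proof.
  induction L as [|a L IH]; simpl; intros H.
  - apply definable_iff with (2 := definable_true st en). firstorder.
  - apply definable_iff with (P := fun w => P a w /\ forall a, In a L -> P a w).
    + intros w. split; [intros [K K'] b [<-|Hb]; auto | auto].
    + apply definable_and; auto.
Qed.

Lemma definable_Exists {W A} (st : W -> str0) (en : forall w, nat -> st w)
    (L : list A) (P : A -> W -> Prop) :
  (forall a, definable st en (P a)) ->
  definable st en (fun w => Exists (fun a => P a w) L).
Proof.
  intros H. induction L as [|a L IH].
  - apply definable_iff with (2 := definable_false st en).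
    intros w. now rewrite Exists_nil.
  - apply definable_iff with (2 := definable_or (H a) IH).
    intros w. now rewrite Exists_cons.
Qed.

(** * Terms as piecewise linear functions of the eliminated variable *)

Record stalk := Stalk {
  st_oag :> oag;
  st_doag : doag st_oag;
  st_env : nat -> st_oag
}.

(** The added point is a value of the variable to be eliminated, so that conditions on this variable
    are predicates on [pstalk]. *)
Record pstalk := PStalk { ps_stalk :> stalk; ps_point : ps_stalk }.

(* [(k, r)] stands for the affine function [k v + r] of the eliminated
   variable [v]. *)
Notation lin := (Z * term L0)%type.

Definition seval (y : stalk) (t : term L0) : y := eval (lin_str y) (st_env y) t.

Definition lval (w : pstalk) (l : lin) : w :=
  zmul (fst l) (ps_point w) + seval w (snd l).

Definition lholds (w : pstalk) (c : bool * lin) : Prop := pos (fst c) (lval w (snd c)).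

Definition lsub (l m : lin) : lin := ((fst l - fst m)%Z, trdiv (snd l) (snd m)).

Lemma lval_sub w l m : lval w (lsub l m) = lval w l - lval w m.
Proof.
  destruct l as [k r], m as [k' r']. unfold lval, seval. simpl.
  change (@eval L0 (lin_str w)) with (fun rho t => eval (lin_str w) rho t : oc w).
  cbv beta. grp.
Qed.

(** The pieces cover everything and may overlap: any piece that applies gives the correct value. *)
Definition piecewise_linear (f : forall w : pstalk, w) : Prop :=
  exists L : list ((pstalk -> Prop) * lin),
    (forall c, In c L -> dnf lholds (fst c)) /\
    forall w, (exists c, In c L /\ fst c w) /\
              forall c, In c L -> fst c w -> f w = lval w (snd c).

Lemma pl_lin l (f : forall w : pstalk, w) :
  (forall w, f w = lval w l) -> piecewise_linear f.
Proof.
  intros Hf. exists [(fun _ => True, l)]. split.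
  - intros c [<-|[]]. apply dnf_true.
  - intros w. split; [eexists; split; [now left|exact I]|].
    intros c [<-|[]] _. apply Hf.
Qed.

(** Each piece of [f], with affine function [l], is refined by the pieces of [F l]. *)
Lemma pl_bind (f h : forall w : pstalk, w) (F : lin -> forall w : pstalk, w) :
  piecewise_linear f -> (forall l, piecewise_linear (F l)) ->
  (forall w l, f w = lval w l -> F l w = h w) -> piecewise_linear h.
Proof.
  intros (L & HL & Hf) HF E.
  (* Covering is weakened to an implication, so that the induction can run over lists of pieces of
     [f] that do not cover everything. *)
  enough (K : exists M : list ((pstalk -> Prop) * lin),
    (forall c, In c M -> dnf lholds (fst c)) /\
    forall w, ((exists c, In c L /\ fst c w) -> exists c, In c M /\ fst c w) /\
              forall c, In c M -> fst c w -> h w = lval w (snd c)).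
  { destruct K as (M & HM & K). exists M. split; auto. intros w.
    destruct (K w). split; auto. apply H, Hf. }
  assert (Hf' : forall w c, In c L -> fst c w -> f w = lval w (snd c)) by (intros w; apply Hf).
  clear Hf. induction L as [|[P l] L IH].
  - exists []. split; [intros c []|]. intros w. split; [intros (c & [] & _)|intros c []].
  - destruct IH as (M & HM & K).
    { intros c Hc. apply HL. now right. }
    { intros w c Hc. apply Hf'. now right. }
    destruct (HF l) as (N & HN & KN).
    exists (map (fun c => (fun w => P w /\ fst c w, snd c)) N ++ M). split.
    + intros c Hc. apply in_app_or in Hc as [Hc|Hc]; auto.
      apply in_map_iff in Hc as (d & <- & Hd). simpl. apply dnf_and; auto.
      apply (HL (P, l)). now left.
    + intros w. split.
      * intros (c & [<-|Hc] & Hcw).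
        -- destruct (proj1 (KN w)) as (d & Hd & Hdw).
           exists (fun w => P w /\ fst d w, snd d). split; [|now split].
           apply in_or_app. left. apply in_map_iff. eauto.
        -- destruct (proj1 (K w)) as (d & Hd & Hdw); [eauto|].
           exists d. split; auto. apply in_or_app. auto.
      * intros c Hc. apply in_app_or in Hc as [Hc|Hc]; [|now apply K].
        apply in_map_iff in Hc as (d & <- & Hd). simpl. intros [HP Hdw].
        rewrite <- (E w l); [now apply KN|]. apply (Hf' w (P, l)); [now left|exact HP].
Qed.

Lemma pl_if (h : forall w : pstalk, w) (l m c : lin) :
  (forall w, 0 <= lval w c -> h w = lval w l) ->
  (forall w, ~ 0 <= lval w c -> h w = lval w m) ->
  piecewise_linear h.
Proof.
  intros Hl Hm.
  exists [(fun w => lholds w (false, c), l);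
          (fun w => lholds w (true, lsub (0%Z, te) c), m)]. split.
  - intros d [<-|[<-|[]]]; apply dnf_lit.
  (* [lsub (0%Z, te) c] is the negative of [c]; its strict positivity expresses that [c] is not
     nonnegative. *)
  - assert (E : forall w, lholds w (true, lsub (0%Z, te) c) <-> ~ 0 <= lval w c).
    { intros w. unfold lholds. rewrite <- pos_opp. cbn [fst snd]. rewrite lval_sub.
      replace (lval w (0%Z, te) - lval w c) with (- lval w c); [tauto|].
      change (lval w (0%Z, te)) with (0 + 0 : w). grp. }
    intros w. split.
    + destruct (classic (0 <= lval w c)) as [K|K].
      * eexists. split; [now left|exact K].
      * eexists. split; [right; now left|]. now apply E.
    + intros d [<-|[<-|[]]] K; [now apply Hl|]. apply Hm, E, K.
Qed.

Lemma pl_binary (op : forall w : pstalk, w -> w -> w) (f g : forall w : pstalk, w) :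
  (forall l m, piecewise_linear (fun w => op w (lval w l) (lval w m))) ->
  piecewise_linear f -> piecewise_linear g -> piecewise_linear (fun w => op w (f w) (g w)).
Proof.
  intros H Hf Hg.
  apply pl_bind with (f := f) (F := fun l w => op w (lval w l) (g w)); auto.
  - intros l. apply pl_bind with (f := g) (F := fun m w => op w (lval w l) (lval w m)); auto.
    now intros w m ->.
  - now intros w l ->.
Qed.

Definition peval (x : nat) (w : pstalk) (t : term L0) : w :=
  eval (lin_str w) (upd (st_env w) x (ps_point w)) t.

(** Group operations keep functions affine; meet, join and [|>] branch on the sign of an affine
    function. *)
Lemma pl_term x t : piecewise_linear (fun w => peval x w t).
Proof.
  induction t.
  - destruct (Nat.eqb_spec n x) as [->|Hn].
    + apply pl_lin with (l := (1%Z, te)). intros w. unfold peval, lval, seval. simpl.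
      rewrite upd_same. grp.
    + apply pl_lin with (l := (0%Z, tvar n)). intros w. unfold peval, lval, seval. simpl.
      rewrite upd_other by exact Hn. grp.
  - destruct c.
  - apply (@pl_binary (fun w => s_meet (lin_str w))); auto. intros l m.
    apply pl_if with (l := l) (m := m) (c := lsub m l);
      intros w; rewrite lval_sub, ole_sub; simpl; intros K; [now apply ite_true|].
    now apply ite_false.
  - apply (@pl_binary (fun w => s_join (lin_str w))); auto. intros l m.
    apply pl_if with (l := m) (m := l) (c := lsub m l);
      intros w; rewrite lval_sub, ole_sub; simpl; intros K; [now apply ite_true|].
    now apply ite_false.
  - apply (@pl_binary (fun w => s_mul (lin_str w))); auto. intros l m.
    (* The sum is written as [l - (0 - m)], subtraction being the available operation on affine
       functions. *)
    apply pl_lin with (l := lsub l (lsub (0%Z, te) m)). intros w. rewrite !lval_sub.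
    change (lval w (0%Z, te)) with (0 + 0 : w). simpl. grp.
  - apply (@pl_binary (fun w => s_ldiv (lin_str w))); auto. intros l m.
    apply pl_lin with (l := lsub m l). intros w. now rewrite lval_sub.
  - apply (@pl_binary (fun w => s_rdiv (lin_str w))); auto. intros l m.
    apply pl_lin with (l := lsub l m). intros w. now rewrite lval_sub.
  - apply pl_lin with (l := (0%Z, te)). intros w. unfold peval, lval, seval. simpl. grp.
  - apply pl_lin with (l := (0%Z, te)). intros w. unfold peval, lval, seval. simpl. grp.
  - apply (@pl_binary (fun w => s_tri (lin_str w))); auto. intros l m.
    apply pl_if with (l := m) (m := (0%Z, te)) (c := l); intros w K; simpl.
    + now apply ite_true.
    + rewrite ite_false by exact K. unfold lval, seval. simpl. grp.
Qed.

Lemma pos_eq0 {D : oag} (x : D) : x = 0 <-> pos false x /\ pos false (0 - x).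
Proof.
  simpl. split.
  - intros ->. rewrite oaddN. split; apply ole_refl.
  - intros [H K]. apply ole_antisym; [now apply ole_sub | exact H].
Qed.

Lemma dnf_lval (b : bool) (l : lin) : dnf lholds (fun w => pos b (lval w l)).
Proof. apply (dnf_lit lholds (b, l)). Qed.

(** Equality is the vanishing of a difference, which is affine on each piece. Vanishing amounts to
    two weak inequalities, and nonvanishing to one of two strict ones. *)
Lemma dnf_peval_eq x s t :
  dnf lholds (fun w => peval x w s = peval x w t) /\
  dnf lholds (fun w => peval x w s <> peval x w t).
Proof.
  destruct (pl_term x (trdiv s t)) as (L & HL & K).
  assert (E : forall w, peval x w s = peval x w t <-> peval x w (trdiv s t) = 0).
  { intros w. change (peval x w (trdiv s t)) with (peval x w s - peval x w t).
    split; [intros ->; apply oaddN|]. intros H.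
    replace (peval x w s) with (peval x w s - peval x w t + peval x w t) by grp.
    rewrite H. apply oadd0l. }
  assert (E0 : forall w l, 0 - lval w l = lval w (lsub (0%Z, te) l)).
  { intros w l. rewrite lval_sub. change (lval w (0%Z, te)) with (0 + 0 : w). grp. }
  assert (D0 : forall l, dnf lholds (fun w => lval w l = 0)).
  { intros l. apply dnf_iff with (P := fun w => pos false (lval w l) /\
      pos false (lval w (lsub (0%Z, te) l))).
    - intros w. now rewrite (pos_eq0 (lval w l)), E0.
    - apply dnf_and; apply dnf_lval. }
  assert (D1 : forall l, dnf lholds (fun w => lval w l <> 0)).
  { intros l. apply dnf_iff with (P := fun w => pos true (lval w l) \/
      pos true (lval w (lsub (0%Z, te) l))).
    - intros w. rewrite pos_eq0, <- E0. unfold pos. rewrite !ole_sub.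
      rewrite <- (ole_sub (0 - _) 0). replace (0 - (0 - lval w l)) with (lval w l) by grp.
      pose proof (ole_total 0 (lval w l)). tauto.
    - apply dnf_or; apply dnf_lval. }
  split.
  - apply dnf_iff with (P := fun w => exists c, In c L /\ (fst c w /\ lval w (snd c) = 0)).
    + intros w. rewrite E. destruct (K w) as [(c & Hc & Hcw) K']. split.
      * intros (d & Hd & Hdw & <-). now apply K'.
      * intros H. exists c. repeat split; auto. now rewrite <- K'.
    + apply dnf_exists. intros c Hc. apply dnf_and; auto.
  - apply dnf_iff with (P := fun w => exists c, In c L /\ (fst c w /\ lval w (snd c) <> 0)).
    + intros w. rewrite E. destruct (K w) as [(c & Hc & Hcw) K']. split.
      * intros (d & Hd & Hdw & N). now rewrite (K' d).
      * intros H. exists c. repeat split; auto. now rewrite <- K'.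
    + apply dnf_exists. intros c Hc. apply dnf_and; auto.
Qed.

Lemma dnf_stalk x p : qfree p ->
  dnf lholds (fun w => sat (lin_str w) (upd (st_env w) x (ps_point w)) p).
Proof.
  intros Hp.
  apply (@dnf_qfree _ _ lholds (fun w => lin_str w)
           (fun w => upd (st_env w) x (ps_point w))); auto.
  apply dnf_peval_eq.
Qed.

(** * Fourier-Motzkin elimination in one ordered group *)

Notation stalk_definable :=
  (@definable stalk (fun y => lin_str y) (fun y => st_env y)).

(** The order is expressed by equations: an element is at most 0 exactly when its join with 0 is
    0. *)
Lemma definable_pos b t : stalk_definable (fun y => pos b (seval y t)).
Proof.
  assert (H : forall t, stalk_definable (fun y => seval y t <= 0)).
  { clear t. intros t. exists (feq (tjoin t te) te). split; [exact I|]. intros y. simpl.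
    fold (seval y t). unfold ite.
    destruct (excluded_middle_informative (seval y t <= 0)); [tauto|].
    split; [tauto|]. intros E. rewrite E in n. destruct n. apply ole_refl. }
  destruct b; simpl.
  - apply definable_iff with (P := fun y => seval y t <= 0 -> False); [tauto|].
    apply definable_imp; [apply H | apply definable_false].
  - apply definable_iff with (P := fun y : stalk => seval y (trdiv te t) <= 0); [|apply H].
    intros y. change (seval y (trdiv te t)) with (0 - seval y t).
    rewrite <- ole_sub. now replace (0 - (0 - seval y t)) with (seval y t) by grp.
Qed.

Fixpoint tmult (n : nat) (t : term L0) : term L0 :=
  match n with O => te | S n => tmul t (tmult n t) end.

Lemma seval_tmult y n t : seval y (tmult n t) = nmul n (seval y t).
Proof.
  induction n as [|n IH]; [reflexivity|].
  change (seval y (tmult (S n) t)) with (seval y t + seval y (tmult n t)). now rewrite IH.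
Qed.

(* One-dimensional Helly for constraints ordered by implication. *)
Lemma strongest_constraint {A V : Type} (P : A -> V -> Prop) (L : list A) :
  (forall a b, In a L -> In b L ->
     (forall v, P a v -> P b v) \/ (forall v, P b v -> P a v)) ->
  L = [] \/ exists a, In a L /\ forall v, P a v -> forall b, In b L -> P b v.
Proof.
  induction L as [|a L IH]; intros H; [now left|right].
  destruct IH as [->|(c & Hc & K)].
  - intros b c Hb Hc. apply H; now right.
  - exists a. split; [now left|]. now intros v Hv b [<-|[]].
  - destruct (H a c) as [E|E]; [now left|now right| |].
    + exists a. split; [now left|]. intros v Hv b [<-|Hb]; auto.
    + exists c. split; [now right|]. intros v Hv b [<-|Hb]; auto.
Qed.

(** Upward closed subsets of a chain are comparable, so among the lower bounds on the eliminated
    variable there is a strongest one. The next lemma does the same for upper bounds. *)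
Lemma monotone_total {D : oag} (P Q : D -> Prop) :
  (forall v w, v <= w -> P v -> P w) -> (forall v w, v <= w -> Q v -> Q w) ->
  (forall v, P v -> Q v) \/ (forall v, Q v -> P v).
Proof.
  intros HP HQ. destruct (classic (forall v, P v -> Q v)) as [|N]; [now left|right].
  apply not_all_ex_not in N as [v N]. apply imply_to_and in N as [Pv NQ].
  intros w Qw. destruct (ole_total v w); [eauto|]. destruct NQ. eauto.
Qed.

Lemma antitone_total {D : oag} (P Q : D -> Prop) :
  (forall v w, v <= w -> P w -> P v) -> (forall v w, v <= w -> Q w -> Q v) ->
  (forall v, P v -> Q v) \/ (forall v, Q v -> P v).
Proof.
  intros HP HQ. destruct (classic (forall v, P v -> Q v)) as [|N]; [now left|right].
  apply not_all_ex_not in N as [v N]. apply imply_to_and in N as [Pv NQ].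
  intros w Qw. destruct (ole_total v w); [|eauto]. destruct NQ. eauto.
Qed.

Lemma lholds_monotone (y : stalk) b k r (v w : y) : (0 < k)%Z -> v <= w ->
  lholds (PStalk y v) (b, (k, r)) -> lholds (PStalk y w) (b, (k, r)).
Proof.
  intros Hk H. apply pos_mono. unfold lval. simpl.
  rewrite <- ole_sub in *. change (seval (PStalk y w) r) with (seval (PStalk y v) r).
  replace (_ - _) with (zmul k (w - v)) by grp. now apply (pos_zmul false).
Qed.

Lemma lholds_antitone (y : stalk) b k r (v w : y) : (k < 0)%Z -> v <= w ->
  lholds (PStalk y w) (b, (k, r)) -> lholds (PStalk y v) (b, (k, r)).
Proof.
  intros Hk H. apply pos_mono. unfold lval. simpl.
  rewrite <- ole_sub in *. change (seval (PStalk y w) r) with (seval (PStalk y v) r).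
  replace (_ - _) with (zmul (- k) (w - v)) by grp. apply (pos_zmul false); [lia|auto].
Qed.

(* The condition for [k v + r] and [m v + s], where [m < 0 < k], to be
   simultaneously (strictly) positive for some [v]. *)
Definition resolvent (c d : bool * lin) : bool * term L0 :=
  ((fst c || fst d)%bool,
   tmul (tmult (Z.to_nat (fst (snd c))) (snd (snd d)))
        (tmult (Z.to_nat (- fst (snd d))) (snd (snd c)))).

Lemma resolvent_spec (y : stalk) c d : (0 < fst (snd c))%Z -> (fst (snd d) < 0)%Z ->
  (exists v : y, lholds (PStalk y v) c /\ lholds (PStalk y v) d) <->
  pos (fst (resolvent c d)) (seval y (snd (resolvent c d))).
Proof.
  destruct c as [b [k r]], d as [b' [m s]]. simpl. intros Hk Hm.
  set (q := seval y _).
  assert (Hq : q = zmul k (seval y s) + zmul (- m) (seval y r)).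
  { transitivity (seval y (tmult (Z.to_nat k) s) + seval y (tmult (Z.to_nat (- m)) r));
      [reflexivity|].
    rewrite !seval_tmult, <- !zmul_nat, !Z2Nat.id by lia. reflexivity. }
  unfold lholds, lval. simpl. split.
  (* Combining the two affine functions with the positive weights [-m] and [k] cancels [v] and
     leaves [q]. *)
  - intros (v & H1 & H2). change (seval (PStalk y v)) with (seval y) in *.
    apply (pos_zmul (k := (- m)%Z)) in H1; [|lia]. apply (pos_zmul (k := k)) in H2; [|lia].
    pose proof (pos_add _ _ _ _ H1 H2) as H.
    replace q with (zmul (- m) (zmul k v + seval y r) + zmul k (zmul m v + seval y s));
      [exact H|]. rewrite Hq. grp.
  (* The witness is the midpoint of the bounds [-r/k] and [-s/m]. There [-2m(kv + r)] and
     [2k(mv + s)] both equal [q], so both affine functions inherit its sign. *)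
  - intros H. destruct (@doag_div y (- (2 * k * m)) (zmul k (seval y s) + zmul m (seval y r)))
      as [v Hv]; [apply st_doag|lia|].
    exists v. change (seval (PStalk y v)) with (seval y).
    apply pos_orb in H as [H1 H2]. split.
    + apply (pos_zmul (k := (- (2 * m))%Z)); [lia|].
      replace (zmul _ _) with q; [exact H1|]. rewrite Hq.
      transitivity (zmul (- (2 * k * m)) v + zmul (- (2 * m)) (seval y r)); [|grp].
      rewrite Hv. grp.
    + apply (pos_zmul (k := (2 * k)%Z)); [lia|].
      replace (zmul _ _) with q; [exact H2|]. rewrite Hq.
      transitivity (- zmul (- (2 * k * m)) v + zmul (2 * k) (seval y s)); [|grp].
      rewrite Hv. grp.
Qed.

Lemma lholds_single (y : stalk) c : fst (snd c) <> 0%Z -> exists v : y, lholds (PStalk y v) c.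
Proof.
  destruct c as [b [k r]]. simpl. intros Hk.
  destruct (doag_pos (st_doag y)) as [z Hz].
  destruct (@doag_div y k (z - seval y r)) as [v Hv]; [apply st_doag|exact Hk|].
  exists v. unfold lholds, lval. simpl. rewrite Hv.
  change (seval (PStalk y v)) with (seval y).
  replace (z - seval y r + seval y r) with z by grp.
  destruct b; [exact Hz|]. now apply pos_false in Hz.
Qed.

Lemma lholds_const (y : stalk) c (v w : y) : fst (snd c) = 0%Z ->
  lholds (PStalk y v) c -> lholds (PStalk y w) c.
Proof. destruct c as [b [k r]]. simpl. now intros ->. Qed.

(** Constraints with coefficient 0 do not depend on the value and are tested at 0. The others bound
    it from below or from above, and each family has a strongest member. The resolvent settles this
    pair; if a family is empty, at most one constraint remains, and it is always satisfiable. *)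
Lemma fourier_motzkin (y : stalk) (L : list (bool * lin)) :
  (exists v : y, Forall (lholds (PStalk y v)) L) <->
  (forall c, In c L -> fst (snd c) = 0%Z -> lholds (PStalk y 0) c) /\
  (forall c, In c L -> forall d, In d L -> (0 < fst (snd c))%Z -> (fst (snd d) < 0)%Z ->
     pos (fst (resolvent c d)) (seval y (snd (resolvent c d)))).
Proof.
  split.
  - intros [v H]. rewrite Forall_forall in H. split.
    + intros c Hc E. apply lholds_const with v; auto.
    + intros c Hc d Hd Hc' Hd'. apply resolvent_spec; eauto.
  - intros [H0 H].
    assert (K : forall v : y,
      (forall c, In c (filter (fun c => 0 <? fst (snd c))%Z L) -> lholds (PStalk y v) c) ->
      (forall c, In c (filter (fun c => fst (snd c) <? 0)%Z L) -> lholds (PStalk y v) c) ->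
      exists v : y, Forall (lholds (PStalk y v)) L).
    { intros v Hp Hn. exists v. apply Forall_forall. intros c Hc.
      destruct (Z.lt_trichotomy 0 (fst (snd c))) as [E|[E|E]].
      - apply Hp, filter_In. split; [auto|now apply Z.ltb_lt].
      - apply lholds_const with (0 : y); [congruence|auto].
      - apply Hn, filter_In. split; [auto|now apply Z.ltb_lt]. }
    destruct (@strongest_constraint (bool * lin) y (fun c v => lholds (PStalk y v) c)
      (filter (fun c => 0 <? fst (snd c))%Z L)) as [Ep|(c & Hc & Sc)].
    { intros [b [k r]] [b' [k' r']] H1 H2. apply filter_In in H1 as [_ H1], H2 as [_ H2]; cbn [fst snd] in H1, H2.
      apply monotone_total; intros v w; apply lholds_monotone; lia. }
    all: destruct (@strongest_constraint (bool * lin) y (fun c v => lholds (PStalk y v) c)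
      (filter (fun c => fst (snd c) <? 0)%Z L)) as [En|(d & Hd & Sd)];
    [intros [b [k r]] [b' [k' r']] H1 H2; apply filter_In in H1 as [_ H1], H2 as [_ H2]; cbn [fst snd] in H1, H2;
      apply antitone_total; intros v w; apply lholds_antitone; lia | | ].
    + apply (K 0); rewrite ?Ep, ?En; intros ? [].
    + apply filter_In in Hd as [_ Hd].
      destruct (lholds_single y d) as [v Hv]; [lia|].
      apply (K v); [rewrite Ep; intros ? []|auto].
    + apply filter_In in Hc as [_ Hc].
      destruct (lholds_single y c) as [v Hv]; [lia|].
      apply (K v); [auto|rewrite En; intros ? []].
    + apply filter_In in Hc as [Lc Hc], Hd as [Ld Hd].
      destruct (proj2 (resolvent_spec y c d ltac:(lia) ltac:(lia))) as (v & Hv & Hv').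
      * apply H; auto; lia.
      * apply (K v); auto.
Qed.

(** The quantifier distributes over the disjunctive normal form, and each conjunction is eliminated
    separately. The signs of the coefficients are fixed integers, hence decided outside the
    formula. *)
Lemma stalk_exists_definable x p : qfree p ->
  stalk_definable (fun y : stalk => exists v : y, sat (lin_str y) (upd (st_env y) x v) p).
Proof.
  intros Hp. destruct (dnf_stalk x p Hp) as [LL HLL].
  apply definable_iff with
    (P := fun y : stalk => Exists (fun L => exists v : y, Forall (lholds (PStalk y v)) L) LL).
  { intros y. rewrite Exists_exists. split.
    - intros (L & HL & v & Hv). exists v. apply (HLL (PStalk y v)), Exists_exists. eauto.
    - intros [v Hv]. apply (HLL (PStalk y v)), Exists_exists in Hv as (L & HL & Hv). eauto. }
  apply definable_Exists. intros L.
  eapply definable_iff; [intros y; symmetry; apply fourier_motzkin|].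
  apply definable_and; apply definable_forall; intros c Hc.
  - destruct (Z.eq_dec (fst (snd c)) 0) as [E|E].
    + apply definable_iff with (2 := definable_pos (fst c) (snd (snd c))).
      intros y. unfold lholds, lval. rewrite E.
      change (zmul 0 _) with (0 : y). rewrite oadd0l. tauto.
    + apply definable_iff with (2 := definable_true _ _). tauto.
  - apply definable_forall. intros d Hd.
    destruct (Z.lt_decidable 0 (fst (snd c))) as [E|E];
      [destruct (Z.lt_decidable (fst (snd d)) 0) as [E'|E'] |].
    + apply definable_iff with
        (2 := definable_pos (fst (resolvent c d)) (snd (resolvent c d))). tauto.
    + apply definable_iff with (2 := definable_true _ _). tauto.
    + apply definable_iff with (2 := definable_true _ _). tauto.
Qed.

(** * Quantifier elimination for periodic sections *)

Local Close Scope oag_scope.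

(* Locally constant sections over the profinite integers vanishing at 0: the
   periodicity makes supports splittable, and the zero at 0 makes sure that no
   section has the largest support. *)
Record sections (I : Type) (D : I -> oag) := Sections {
  sec_fun :> nat -> forall i, D i;
  sec_periodic : exists k, 0 < k /\ forall n i, sec_fun (n + k) i = sec_fun n i;
  sec_zero : forall i, sec_fun 0 i = ozero
}.

Lemma sec_ext (I : Type) (D : I -> oag) (f g : sections D) :
  (forall n i, f n i = g n i) -> f = g.
Proof.
  destruct f as [f Pf Zf], g as [g Pg Zg]. simpl. intros H.
  assert (f = g) as <-.
  { apply functional_extensionality. intros n.
    now apply functional_extensionality_dep. }
  f_equal; apply proof_irrelevance.
Qed.

Lemma periodic_mult (A : Type) (f : nat -> A) k : (forall n, f (n + k) = f n) ->
  forall c n, f (n + k * c) = f n.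
Proof.
  intros H c. induction c as [|c IH]; intros n; [now rewrite Nat.mul_0_r, Nat.add_0_r|].
  replace (n + k * S c) with (n + k * c + k) by lia. now rewrite H.
Qed.

Definition sec_const (I : Type) (D : I -> oag) : sections D.
Proof.
  refine (@Sections I D (fun _ i => ozero) _ _); [|reflexivity].
  exists 1. auto.
Defined.

Definition sec_map2 (I : Type) (D : I -> oag) (op : forall i, D i -> D i -> D i)
  (op0 : forall i, op i ozero ozero = ozero) (f g : sections D) : sections D.
Proof.
  refine (@Sections I D (fun n i => op i (f n i) (g n i)) _ _).
  - destruct (sec_periodic f) as (k & Hk & Pf), (sec_periodic g) as (l & Hl & Pg).
    exists (k * l). split; [lia|]. intros n i. f_equal.
    + apply (@periodic_mult _ (fun n => f n i)); auto.
    + rewrite Nat.mul_comm. apply (@periodic_mult _ (fun n => g n i)); auto.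
  - intros i. rewrite (sec_zero f i), (sec_zero g i). apply op0.
Defined.

Lemma ite_same (P : Prop) (A : Type) (x : A) : ite P x x = x.
Proof. unfold ite. now destruct (excluded_middle_informative P). Qed.

Definition sec_str (I : Type) (D : I -> oag) : str0 :=
  @Structure L0 (sections D)
    (@sec_map2 I D (fun i => s_meet (lin_str (D i))) (fun i => @ite_same _ _ _))
    (@sec_map2 I D (fun i => s_join (lin_str (D i))) (fun i => @ite_same _ _ _))
    (@sec_map2 I D (fun i => s_mul (lin_str (D i))) (fun i => oadd0 _))
    (@sec_map2 I D (fun i => s_ldiv (lin_str (D i))) (fun i => oaddN _))
    (@sec_map2 I D (fun i => s_rdiv (lin_str (D i))) (fun i => oaddN _))
    (sec_const D) (sec_const D)
    (@sec_map2 I D (fun i => s_tri (lin_str (D i))) (fun i => @ite_same _ _ _))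
    (fun c => match c with end).

Definition at_point (I : Type) (D : I -> oag) (rho : nat -> sections D) n i : nat -> D i :=
  fun m => rho m n i.

Lemma eval_at (I : Type) (D : I -> oag) (rho : nat -> sections D) n i t :
  (eval (sec_str D) rho t : sections D) n i =
  eval (lin_str (D i)) (at_point rho n i) t.
Proof.
  induction t; simpl; rewrite <- ?IHt1, <- ?IHt2; auto. destruct c.
Qed.

Lemma eval_eq_at (I : Type) (D : I -> oag) (rho : nat -> sections D) s t :
  eval (sec_str D) rho s = eval (sec_str D) rho t <->
  forall n i, eval (lin_str (D i)) (at_point rho n i) s =
              eval (lin_str (D i)) (at_point rho n i) t.
Proof.
  setoid_rewrite <- eval_at. split; [now intros ->|].
  intros H. now apply sec_ext.
Qed.

(** * Expressing that a condition holds at some point *)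

Lemma eval_zero (D : oag) t : eval (lin_str D) (fun _ => ozero) t = ozero.
Proof.
  induction t; simpl; rewrite ?IHt1, ?IHt2; auto using ite_same, oadd0, oaddN.
  destruct c.
Qed.

(** All terms vanish at the zero assignment, so atoms are true there in every ordered group, and the
    truth value of the whole formula does not depend on the group. *)
Lemma sat_zero p : qfree p ->
  (forall D : oag, sat (lin_str D) (fun _ => ozero) p) \/
  (forall D : oag, ~ sat (lin_str D) (fun _ => ozero) p).
Proof.
  induction p; simpl; intros H; try tauto.
  - left. intros D. now rewrite !eval_zero.
  - destruct (IHp1 (proj1 H)), (IHp2 (proj2 H)); firstorder.
  - destruct (IHp1 (proj1 H)), (IHp2 (proj2 H)); firstorder.
  - destruct (IHp1 (proj1 H)), (IHp2 (proj2 H)); firstorder.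
Qed.

(* Equals [w] where [p] holds and [e] elsewhere. *)
Fixpoint tind (p : formula L0) (w : term L0) : term L0 :=
  match p with
  | feq s t => ttri (tmeet (trdiv s t) (trdiv t s)) w
  | fimp a b => trdiv w (tind a (trdiv w (tind b w)))
  | fand a b => tind a (tind b w)
  | for_ a b => let w' := trdiv w (tind b w) in trdiv w (trdiv w' (tind a w'))
  | _ => te
  end.

Lemma ole_antisym_iff (D : oag) (x y : D) :
  ole ozero (ite (ole (oadd x (oopp y)) (oadd y (oopp x)))
                 (oadd x (oopp y)) (oadd y (oopp x))) <-> x = y.
Proof.
  split.
  - unfold ite. destruct (excluded_middle_informative _) as [H|H]; intros K.
    + pose proof (ole_trans _ _ _ K H). apply ole_antisym; now apply ole_sub.
    + assert (H' : ole (oadd y (oopp x)) (oadd x (oopp y))).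
      { destruct (ole_total (oadd y (oopp x)) (oadd x (oopp y))); tauto. }
      pose proof (ole_trans _ _ _ K H'). apply ole_antisym; now apply ole_sub.
  - intros ->. rewrite oaddN, ite_same. apply ole_refl.
Qed.

Ltac ites p q :=
  simpl; destruct (classic p), (classic q);
  repeat first [rewrite ite_true by tauto | rewrite ite_false by tauto
               | rewrite oaddN | rewrite oopp0 | rewrite oadd0]; reflexivity.

(** Two elements agree exactly when the meet of their two differences is nonnegative, which [|>] can
    test. Subtraction from [w] acts as complementation of the set to which [w] is restricted, and
    this yields the connectives. *)
Lemma eval_tind (D : oag) rho p : qfree p -> forall w,
  eval (lin_str D) rho (tind p w) = ite (sat (lin_str D) rho p) (eval (lin_str D) rho w) ozero.
Proof.
  induction p; cbn [qfree tind sat]; intros H w; try tauto.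
  - now rewrite ite_false.
  - simpl. unfold ite at 1 3.
    pose proof (ole_antisym_iff D (eval (lin_str D) rho t) (eval (lin_str D) rho t0)) as E.
    destruct (excluded_middle_informative (ole _ _)), (excluded_middle_informative _);
      simpl in *; tauto.
  - cbn [eval]. rewrite IHp1 by tauto. cbn [eval]. rewrite IHp2 by tauto. ites (sat (lin_str D) rho p1) (sat (lin_str D) rho p2).
  - rewrite IHp1, IHp2 by tauto. ites (sat (lin_str D) rho p1) (sat (lin_str D) rho p2).
  - cbv zeta. cbn [eval]. rewrite IHp1 by tauto. cbn [eval]. rewrite IHp2 by tauto. ites (sat (lin_str D) rho p1) (sat (lin_str D) rho p2).
Qed.

Definition tabs (t : term L0) : term L0 := tjoin t (trdiv te t).

(** The sum of the absolute values of the first [N] variables: a weight that vanishes only where all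
    of these variables vanish. *)
Fixpoint tunit (N : nat) : term L0 :=
  match N with O => te | S N => tmul (tabs (tvar N)) (tunit N) end.

Lemma eval_tabs (D : oag) rho t :
  ole ozero (eval (lin_str D) rho (tabs t)) /\
  (ole (eval (lin_str D) rho (tabs t)) ozero -> eval (lin_str D) rho t = ozero).
Proof.
  simpl. set (x := eval (lin_str D) rho t : oc D).
  assert (E : ole ozero (oadd ozero (oopp x)) <-> ole x ozero) by apply ole_sub.
  assert (E' : ole (oadd ozero (oopp x)) ozero <-> ole ozero x).
  { rewrite <- ole_sub. replace (oadd _ _) with x by grp. tauto. }
  pose proof (ole_total x ozero).
  unfold ite. destruct (excluded_middle_informative _) as [K|K]; split.
  - destruct H; [tauto|]. now apply ole_trans with x.
  - intros H'. pose proof (ole_trans _ _ _ K H'). apply ole_antisym; tauto.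
  - destruct H; [|tauto]. destruct K. apply ole_trans with ozero; tauto.
  - intros H'. destruct H; [|now apply ole_antisym].
    destruct K. apply ole_trans with ozero; tauto.
Qed.

Lemma eval_tunit (D : oag) rho N :
  ole ozero (eval (lin_str D) rho (tunit N)) /\
  (ole (eval (lin_str D) rho (tunit N)) ozero -> forall m, m < N -> rho m = ozero).
Proof.
  induction N as [|N [IH1 IH2]]; cbn [tunit eval].
  - split; [apply ole_refl|lia].
  - destruct (eval_tabs D rho (tvar N)) as [H1 H2]. simpl s_mul.
    set (a := eval (lin_str D) rho (tabs (tvar N)) : oc D) in *.
    set (b := eval (lin_str D) rho (tunit N) : oc D) in *.
    pose proof (ole_add_nonneg a b H1). pose proof (ole_add_nonneg b a IH1).
    rewrite oaddC in H0. split.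
    + now apply ole_trans with b.
    + intros K m Hm. destruct (Nat.eq_dec m N) as [->|].
      * apply H2. now apply ole_trans with (oadd a b).
      * apply IH2; [|lia]. now apply ole_trans with (oadd a b).
Qed.

(** [sw_base] makes the index set nonempty, which guarantees a point with [n = 0], where every
    section vanishes. *)
Record secworld := SecWorld {
  sw_index : Type;
  sw_oag : sw_index -> oag;
  sw_base : sw_index;
  sw_doag : forall i, doag (sw_oag i);
  sw_env : nat -> sections sw_oag
}.

Notation sec_definable :=
  (@definable secworld (fun w => sec_str (sw_oag w)) (fun w => sw_env w)).

Definition holds_at (w : secworld) n i (p : formula L0) : Prop :=
  sat (lin_str (sw_oag w i)) (at_point (sw_env w) n i) p.

Lemma at_zero (I : Type) (D : I -> oag) (rho : nat -> sections D) i :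
  at_point rho 0 i = fun _ => ozero.
Proof. apply functional_extensionality. intros m. apply sec_zero. Qed.

(** A formula true at the zero assignment holds at [n = 0]. Otherwise, wherever [p] holds, some
    variable of [p] is nonzero, and so is [tunit N]. The section [tind p (tunit N)] is therefore
    nonzero exactly when [p] holds somewhere. *)
Lemma definable_somewhere p : qfree p ->
  sec_definable (fun w => exists n i, holds_at w n i p).
Proof.
  intros Hp. destruct (sat_zero p Hp) as [H0|H0].
  - apply definable_iff with (2 := definable_true _ _). intros w. split; [intros _|tauto].
    exists 0, (sw_base w). unfold holds_at. rewrite at_zero. apply H0.
  - destruct (ffree_bounded p) as [N HN].
    exists (fnot (feq (tind p (tunit N)) te)). split; [simpl; tauto|].
    intros w. cbn [fnot sat]. rewrite eval_eq_at.
    assert (E : forall n i, eval (lin_str (sw_oag w i)) (at_point (sw_env w) n i)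
        (tind p (tunit N)) = ozero <-> ~ holds_at w n i p).
    { intros n i. rewrite eval_tind by exact Hp. fold (holds_at w n i p).
      unfold ite. destruct (excluded_middle_informative _) as [K|K]; [|tauto].
      split; [|tauto]. intros U _. apply (H0 (sw_oag w i)).
      revert K. apply sat_ext. intros m Hm. symmetry.
      apply (proj2 (eval_tunit _ (at_point (sw_env w) n i) N)); [|now apply HN].
      rewrite U. apply ole_refl. }
    change (forall n i, _ = eval (lin_str (sw_oag w i)) _ te) with
      (forall n i, eval (lin_str (sw_oag w i)) (at_point (sw_env w) n i)
        (tind p (tunit N)) = ozero).
    setoid_rewrite E. firstorder. apply NNPP. firstorder.
Qed.

Definition sat_at (w : secworld) x n i (v : sw_oag w i) (p : formula L0) : Prop :=
  sat (lin_str (sw_oag w i)) (upd (at_point (sw_env w) n i) x v) p.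

(** The fibre at a point is a stalk, so the uniform elimination for stalks provides one formula for
    all points of all worlds. *)
Lemma definable_sat_at x p : qfree p -> exists q, qfree q /\
  forall w n i, (exists v, sat_at w x n i v p) <-> holds_at w n i q.
Proof.
  intros Hp. destruct (stalk_exists_definable x p Hp) as (q & Hq & E).
  exists q. split; auto. intros w n i.
  apply (E (Stalk (sw_doag w i) (at_point (sw_env w) n i))).
Qed.

Lemma definable_everywhere p : qfree p ->
  sec_definable (fun w => forall n i, holds_at w n i p).
Proof.
  intros Hp.
  apply definable_iff with (P := fun w => (exists n i, holds_at w n i (fnot p)) -> False).
  - intros w. split; [|firstorder]. intros H n i. apply NNPP. intros K. apply H.
    now exists n, i.
  - apply definable_imp; [|apply definable_false]. apply definable_somewhere. simpl. tauto.
Qed.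

(** * Patching local solutions into one periodic section *)

Lemma common_period (I : Type) (D : I -> oag) (rho : nat -> sections D) N :
  exists K, 0 < K /\ forall m, m < N -> forall n i, rho m (n + K) i = rho m n i.
Proof.
  induction N as [|N (K & HK & IH)]; [exists 1; split; lia|].
  destruct (sec_periodic (rho N)) as (k & Hk & E). exists (K * k). split; [lia|].
  intros m Hm n i. destruct (Nat.eq_dec m N) as [->|].
  - rewrite Nat.mul_comm. apply (@periodic_mult _ (fun n => rho N n i)). auto.
  - apply (@periodic_mult _ (fun n => rho m n i)). intros. apply IH. lia.
Qed.

(** The boolean is [true] for an equation and [false] for a disequation. *)
Notation equation := (bool * (term L0 * term L0))%type.

Definition eqs (L : list equation) : formula L0 :=
  fold_right (fun (c : equation) g => if fst c then fand (feq (fst (snd c)) (snd (snd c))) g else g)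
    (fimp fbot fbot) L.

(** A local witness of a disequation must also solve the equations, since the patched section has to
    solve them everywhere. *)
Definition constraint (L : list equation) (c : equation) : formula L0 :=
  fand (eqs L) (fnot (feq (fst (snd c)) (snd (snd c)))).

Lemma qfree_eqs L : qfree (eqs L).
Proof. induction L as [|[[] [s t]] L IH]; simpl; auto. Qed.

Lemma sat_eqs (S : str0) rho L : sat S rho (eqs L) <->
  forall c, In c L -> fst c = true -> eval S rho (fst (snd c)) = eval S rho (snd (snd c)).
Proof.
  induction L as [|[[] [s t]] L IH]; simpl.
  - firstorder.
  - rewrite IH. split.
    + intros [H K] c [<-|Hc]; auto.
    + intros H. split; [|auto]. apply (H (true, (s, t))); auto.
  - rewrite IH. split; [|auto]. intros K c [<-|Hc]; [discriminate|auto].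
Qed.

Definition eholds (w : secworld) x (f : sections (sw_oag w)) (c : equation) : Prop :=
  let ev := eval (sec_str (sw_oag w)) (upd (sw_env w) x f) in
  if fst c then ev (fst (snd c)) = ev (snd (snd c)) else ev (fst (snd c)) <> ev (snd (snd c)).

Lemma at_point_upd (I : Type) (D : I -> oag) (rho : nat -> sections D) x f n i :
  at_point (upd rho x f) n i = upd (at_point rho n i) x (f n i).
Proof. apply (upd_map (fun g : sections D => g n i)). Qed.

Lemma eqs_bounded (L : list equation) : exists N, forall c, In c L ->
  (forall m, ffree m (constraint L c) -> m < N).
Proof.
  enough (H : forall M : list equation, exists N, forall c, In c M ->
    (forall m, ffree m (constraint L c) -> m < N)) by apply H.
  induction M as [|c M (N & HN)]; [exists 0; intros c []|].
  destruct (ffree_bounded (constraint L c)) as [N' HN']. exists (N + N').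
  intros d [<-|Hd] m Hm; [apply HN' in Hm | apply (HN d Hd) in Hm]; lia.
Qed.

(* Finitely many disequations can be realised at distinct points: shifting a
   point by a common period of the parameters does not change its fibre. *)
Lemma patching (w : secworld) x (L : list equation) :
  (exists f, Forall (eholds w x f) L) <->
  (forall n i, exists v, sat_at w x n i v (eqs L)) /\
  (forall c, In c L -> fst c = false ->
     exists n i v, sat_at w x n i v (constraint L c)).
Proof.
  split.
  - intros [f Hf]. rewrite Forall_forall in Hf.
    assert (E : forall n i, sat_at w x n i (f n i) (eqs L)).
    { intros n i. apply sat_eqs. intros c Hc Hb. specialize (Hf c Hc).
      unfold eholds in Hf. rewrite Hb, eval_eq_at in Hf.
      specialize (Hf n i). now rewrite at_point_upd in Hf. }
    split; [eauto|]. intros c Hc Hb. specialize (Hf c Hc).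
    unfold eholds in Hf. rewrite Hb, eval_eq_at in Hf.
    apply not_all_ex_not in Hf as [n Hf]. apply not_all_ex_not in Hf as [i Hf].
    exists n, i, (f n i). split; [apply E|]. now rewrite at_point_upd in Hf.
  - intros [Heq Hne].
    destruct (ffree_bounded (eqs L)) as [N1 HN1]. destruct (eqs_bounded L) as [N2 HN2].
    (* Only the finitely many variables that occur in the conditions are given a common period. *)
    destruct (common_period (sw_env w) (N1 + N2)) as (K & HK & Per).
    set (d := (true, (te, te)) : equation).
    assert (Hch : exists P : nat -> nat * sw_index w, forall j, j < length L ->
      fst (nth j L d) = false ->
      exists v, sat_at w x (fst (P j)) (snd (P j)) v (constraint L (nth j L d))).
    { apply (choice (fun j (P : nat * sw_index w) => j < length L ->
        fst (nth j L d) = false ->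
        exists v, sat_at w x (fst P) (snd P) v (constraint L (nth j L d)))).
      intros j. destruct (classic (j < length L /\ fst (nth j L d) = false)) as [[Hj Hb]|Hj].
      - destruct (Hne (nth j L d)) as (n & i & Hv); auto using nth_In.
        now exists (n, i).
      - exists (0, sw_base w). tauto. }
    destruct Hch as [P HP].
    assert (Shift : forall p, (forall m, ffree m p -> m < N1 + N2) -> forall n n' i v,
      n mod K = n' mod K -> sat_at w x n i v p -> sat_at w x n' i v p).
    { intros p Hp n n' i v E. apply sat_ext. intros m Hm. unfold upd.
      destruct (Nat.eqb m x); auto. unfold at_point.
      assert (Red : forall n, sw_env w m n i = sw_env w m (n mod K) i).
      { intros k.
        transitivity (sw_env w m (k mod K + K * (k / K)) i).
        - now rewrite Nat.add_comm, <- Nat.div_mod_eq.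
        - apply (@periodic_mult _ (fun n => sw_env w m n i)). auto. }
      now rewrite (Red n), (Red n'), E. }
    assert (Beq : forall m, ffree m (eqs L) -> m < N1 + N2).
    { intros m Hm. apply HN1 in Hm. lia. }
    assert (Bne : forall c, In c L -> forall m, ffree m (constraint L c) -> m < N1 + N2).
    { intros c Hc m Hm. apply (HN2 c Hc) in Hm. lia. }
    (* The [j]-th disequation is moved to an index in the same residue class modulo [K], inside
       block number [j + 1] of length [K]. Different blocks keep the indices distinct, and block 0
       is avoided because sections vanish at 0. *)
    set (pt := fun j => fst (P j) mod K + K * (j + 1)).
    set (K' := K * (length L + 1)).
    assert (Hpt : forall j, j < length L -> pt j < K').
    { intros j Hj. unfold pt, K'. pose proof (Nat.mod_upper_bound (fst (P j)) K). nia. }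
    assert (Hpt0 : forall j, pt j <> 0) by (intros j; unfold pt; nia).
    assert (Hdiv : forall j, pt j / K = j + 1).
    { intros j. unfold pt. rewrite Nat.mul_comm, Nat.div_add by lia.
      now rewrite Nat.div_small by (apply Nat.mod_upper_bound; lia). }
    assert (Hmod : forall j, pt j mod K = fst (P j) mod K).
    { intros j. unfold pt. rewrite Nat.mul_comm, Nat.Div0.mod_add.
      apply Nat.Div0.mod_mod. }
    (* The value is the chosen witness at a distinguished point, 0 at [n = 0], and any solution of
       the equations elsewhere. *)
    assert (Hv : forall n i, exists v, sat_at w x n i v (eqs L) /\
      (forall j, j < length L -> fst (nth j L d) = false -> n = pt j -> i = snd (P j) ->
         sat_at w x n i v (constraint L (nth j L d))) /\
      (n = 0 -> v = ozero)).
    { intros n i.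
      destruct (classic (exists j, j < length L /\ fst (nth j L d) = false /\
        n = pt j /\ i = snd (P j))) as [(j & Hj & Hb & -> & ->)|Hno].
      - destruct (HP j Hj Hb) as [v Hv]. exists v.
        assert (Sv : sat_at w x (pt j) (snd (P j)) v (constraint L (nth j L d))).
        { apply Shift with (3 := Hv); [apply Bne, nth_In, Hj|]. symmetry. apply Hmod. }
        split; [apply Sv|]. split; [|intros H0; now apply Hpt0 in H0].
        intros j' _ _ E _. assert (j' = j) as ->; [|exact Sv].
        pose proof (Hdiv j). pose proof (Hdiv j'). rewrite E in H. lia.
      - destruct (Nat.eq_dec n 0) as [->|Hn].
        + exists ozero. split; [|split; [|auto]].
          (* With all parameters and the new value equal to 0, both sides of every equation are
             0. *)
          * unfold sat_at. rewrite at_zero. apply sat_eqs. intros c _ _.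
            assert (E : upd (fun _ => ozero) x ozero = fun _ : nat => @ozero (sw_oag w i)).
            { apply functional_extensionality. intros m. unfold upd.
              now destruct (Nat.eqb m x). }
            rewrite E, !eval_zero. reflexivity.
          * intros j Hj _ H0. symmetry in H0. now apply Hpt0 in H0.
        + destruct (Heq n i) as [v Hv]. exists v. split; auto. split; [|tauto].
          intros j Hj Hb E E'. destruct Hno. eauto. }
    set (g := fun n i => proj1_sig (constructive_indefinite_description _ (Hv n i))).
    assert (Hg : forall n i, _) by
      exact (fun n i => proj2_sig (constructive_indefinite_description _ (Hv n i))).
    change (forall n i, sat_at w x n i (g n i) (eqs L) /\
      (forall j, j < length L -> fst (nth j L d) = false -> n = pt j -> i = snd (P j) ->
         sat_at w x n i (g n i) (constraint L (nth j L d))) /\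
      (n = 0 -> g n i = ozero)) in Hg.
    assert (HK' : 0 < K') by (unfold K'; nia).
    (* The values below [K'] are repeated with period [K']. As [K'] is a multiple of [K], reduction
       modulo [K'] does not change the relevant parameters; as it exceeds every [pt j], the
       distinguished values are kept. *)
    unshelve epose (f := @Sections _ (sw_oag w) (fun n i => g (n mod K') i) _ _).
    { exists K'. split; [exact HK'|]. intros n i.
      now rewrite <- (Nat.Div0.mod_add n 1 K'), Nat.mul_1_l. }
    { intros i. cbv beta. rewrite Nat.Div0.mod_0_l. now apply Hg. }
    assert (Red : forall n, n mod K' mod K = n mod K).
    { intros n. unfold K'. rewrite Nat.Div0.mod_mul_r, (Nat.mul_comm K), Nat.Div0.mod_add.
      apply Nat.Div0.mod_mod. }
    exists f. apply Forall_forall. intros c Hc. unfold eholds.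
    destruct (fst c) eqn:Hb; rewrite eval_eq_at.
    + intros n i. rewrite at_point_upd.
      assert (S : sat_at w x n i (f n i) (eqs L)).
      { apply Shift with (n mod K'); [exact Beq|apply Red|apply Hg]. }
      unfold sat_at in S. rewrite sat_eqs in S. now apply S.
    + intros H. destruct (In_nth _ _ d Hc) as (j & Hj & <-).
      specialize (H (pt j) (snd (P j))). rewrite at_point_upd in H.
      assert (S : sat_at w x (pt j) (snd (P j)) (f (pt j) (snd (P j)))
                    (constraint L (nth j L d))).
      { simpl. rewrite (Nat.mod_small _ _ (Hpt j Hj)). now apply Hg. }
      now apply S.
Qed.

(** On each disjunct, [patching] replaces the quantifier over sections by local solvability at every
    point and at some point. Local solvability is quantifier-free by elimination in the stalks. *)
Lemma sec_exists_definable x p : qfree p ->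
  sec_definable (fun w => exists f, sat (sec_str (sw_oag w)) (upd (sw_env w) x f) p).
Proof.
  intros Hp.
  destruct (@dnf_qfree {w : secworld & sections (sw_oag w)} equation
    (fun X c => eholds (projT1 X) x (projT2 X) c)
    (fun X => sec_str (sw_oag (projT1 X)))
    (fun X => upd (sw_env (projT1 X)) x (projT2 X))) with (p := p) as [[LL HLL] _]; auto.
  { intros s t. split.
    - apply (dnf_lit (fun (X : {w : secworld & sections (sw_oag w)}) c =>
        eholds (projT1 X) x (projT2 X) c) (true, (s, t))).
    - apply (dnf_lit (fun (X : {w : secworld & sections (sw_oag w)}) c =>
        eholds (projT1 X) x (projT2 X) c) (false, (s, t))). }
  apply definable_iff with
    (P := fun w => Exists (fun L => exists f, Forall (eholds w x f) L) LL).
  { intros w. rewrite Exists_exists. split.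
    - intros (L & HL & f & Hf). exists f. apply (HLL (existT _ w f)), Exists_exists. eauto.
    - intros [f Hf]. apply (HLL (existT _ w f)), Exists_exists in Hf as (L & HL & Hf).
      eauto. }
  apply definable_Exists. intros L.
  eapply definable_iff; [intros w; symmetry; apply patching|].
  apply definable_and.
  - destruct (definable_sat_at x (eqs L) (qfree_eqs L)) as (q & Hq & E).
    apply definable_iff with (2 := definable_everywhere q Hq).
    intros w. setoid_rewrite E. tauto.
  - apply definable_forall. intros c _. destruct (fst c).
    + apply definable_iff with (2 := definable_true _ _). intros w. split; [discriminate|auto].
    + destruct (definable_sat_at x (constraint L c)) as (q & Hq & E).
      { simpl. pose proof (qfree_eqs L). tauto. }
      apply definable_iff with (2 := definable_somewhere q Hq).
      intros w. setoid_rewrite E. tauto.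
Qed.

Lemma sections_qe p :
  sec_definable (fun w => sat (sec_str (sw_oag w)) (sw_env w) p).
Proof.
  assert (EX : forall n p,
    sec_definable (fun w => sat (sec_str (sw_oag w)) (sw_env w) p) ->
    sec_definable (fun w => sat (sec_str (sw_oag w)) (sw_env w) (fex n p))).
  { clear p. intros n p (q & Hq & E).
    apply definable_iff with (2 := sec_exists_definable n q Hq).
    intros w. simpl. split; intros [f Hf]; exists f;
      (* Definability speaks of all worlds, in particular of the one whose environment is updated at
         [n]. *)
      apply (E (SecWorld (sw_base w) (sw_doag w) (upd (sw_env w) n f))), Hf. }
  induction p.
  - apply definable_false.
  - now apply (definable_qf _ _ (feq t t0)).
  - now apply definable_imp.
  - now apply definable_and.
  - now apply definable_or.
  - apply definable_iff with
      (P := fun w => sat (sec_str (sw_oag w)) (sw_env w) (fex n (fnot p)) -> False).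
    + intros w. simpl. split; [|firstorder].
      intros H f. apply NNPP. intros K. apply H. now exists f.
    + apply definable_imp; [|apply definable_false]. apply EX.
      apply definable_imp; [exact IHp|apply definable_false].
  - now apply EX.
Qed.

(** * Embedding the algebras of the variety into sections *)

Lemma lin_str_linear (D : oag) : linear_LAtri (lin_str D).
Proof.
  exists oopp, ole. simpl.
  assert (le_ite : forall x y : D, ole x y ->
    (ite (ole x y) x y = x /\ ite (ole x y) y x = y) /\
    (ite (ole y x) y x = x /\ ite (ole y x) x y = y)).
  { intros x y H. rewrite !(ite_true _ _ H). unfold ite.
    destruct (excluded_middle_informative (ole y x)); auto using ole_antisym. }
  repeat match goal with |- _ /\ _ => split end;
    try solve [exact oaddA | exact oaddC | exact oadd0 | exact oaddN | exact ole_refl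
      | exact ole_antisym | exact ole_trans | exact ole_total | exact ole_add | reflexivity].
  - intros x y H. apply (le_ite x y H).
  - intros x y H. apply (le_ite y x H).
  - intros x y H. now apply ite_true.
  - intros x y H. now apply ite_false.
Qed.

(** Extensionality gives an equality of structures, so a linear algebra can simply be replaced by
    [lin_str D] in an identity. *)
Lemma linear_lin_str (K : str0) : linear_LAtri K -> exists D, K = lin_str D.
Proof.
  destruct K as [A meet join mul ldiv rdiv e z tri cst]. unfold linear_LAtri. simpl.
  intros (inv & le & H1 & H2 & H3 & H4 & H5 & H6 & H7 & H8 & H9 & H10 & H11 & H12 & H13
          & -> & H14 & H15).
  exists (@OAG A mul inv e le H1 H2 H3 H4 H6 H7 H8 H9). unfold lin_str. simpl.
  assert (le_not : forall x y, ~ le x y -> le y x).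
  { intros x y. destruct (H8 x y); tauto. }
  f_equal; repeat (apply functional_extensionality; intro); auto.
  - unfold ite. destruct (excluded_middle_informative _);
      [now apply H10 | now apply H11, le_not].
  - unfold ite. destruct (excluded_middle_informative _);
      [now apply H10 | now apply H11, le_not].
  - unfold ite. destruct (excluded_middle_informative _); auto.
  - now destruct x.
Qed.

(** An equation is verified in ordered groups by case analysis on [ite], and then holds throughout
    the variety. *)
Lemma identity {M : str0} (s t : term L0) : in_LAtri M ->
  (forall (D : oag) (rho : nat -> D), eval (lin_str D) rho s = eval (lin_str D) rho t) ->
  forall rho, eval M rho s = eval M rho t.
Proof.
  intros HM H. apply HM. intros K HK. destruct (linear_lin_str HK) as [D ->]. apply H.
Qed.

Definition env4 (A : Type) (x y z a : A) (n : nat) : A :=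
  match n with 0 => x | 1 => y | 2 => z | _ => a end.

Notation X0 := (tvar 0).
Notation X1 := (tvar 1).
Notation X2 := (tvar 2).
Notation X3 := (tvar 3).

Ltac lin_identity :=
  intros D rho; simpl;
  match goal with |- @eq _ ?a ?b => change (@eq (oc D) a b) end;
  unfold ite; repeat destruct (excluded_middle_informative _);
  try contradiction; try reflexivity; try grp.

Lemma mulA {M : str0} (HM : in_LAtri M) (x y z : M) :
  s_mul M x (s_mul M y z) = s_mul M (s_mul M x y) z.
Proof.
  apply (@identity M (tmul X0 (tmul X1 X2)) (tmul (tmul X0 X1) X2) HM) with
    (rho := env4 x y z x). lin_identity.
Qed.

Lemma mulC {M : str0} (HM : in_LAtri M) (x y : M) : s_mul M x y = s_mul M y x.
Proof.
  apply (@identity M (tmul X0 X1) (tmul X1 X0) HM) with (rho := env4 x y x x).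
  lin_identity.
Qed.

Lemma mule {M : str0} (HM : in_LAtri M) (x : M) : s_mul M x (s_e M) = x.
Proof.
  apply (@identity M (tmul X0 te) X0 HM) with (rho := env4 x x x x). lin_identity.
Qed.

Lemma rdivK {M : str0} (HM : in_LAtri M) (x y : M) : s_mul M y (s_rdiv M x y) = x.
Proof.
  apply (@identity M (tmul X1 (trdiv X0 X1)) X0 HM) with (rho := env4 x y x x).
  lin_identity.
Qed.

Lemma ldivK {M : str0} (HM : in_LAtri M) (x y : M) : s_mul M x (s_ldiv M x y) = y.
Proof.
  apply (@identity M (tmul X0 (tldiv X0 X1)) X1 HM) with (rho := env4 x y x x).
  lin_identity.
Qed.

Lemma zero_e {M : str0} (HM : in_LAtri M) : s_zero M = s_e M.
Proof.
  apply (@identity M tzero te HM) with (rho := fun _ => s_e M). lin_identity.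
Qed.

(* [sact M (x, true)] is the identity at the stalks where [x] is nonnegative
   and trivial at the others, and conversely for [sact M (x, false)]. *)
Definition sact (M : str0) (c : M * bool) (z : M) : M :=
  if snd c then s_tri M (fst c) z else s_rdiv M z (s_tri M (fst c) z).

Definition sacts (M : str0) (l : list (M * bool)) (z : M) : M := fold_right (sact M) z l.

(** The term counterpart of [sact], with which identities about the actions are stated and
    transferred to the variety. *)
Definition tact (c : term L0 * bool) (z : term L0) : term L0 :=
  if snd c then ttri (fst c) z else trdiv z (ttri (fst c) z).

Definition tacts (l : list (term L0 * bool)) (z : term L0) : term L0 := fold_right tact z l.

Lemma sact_mul {M : str0} (HM : in_LAtri M) c (x y : M) :
  sact M c (s_mul M x y) = s_mul M (sact M c x) (sact M c y).
Proof.
  destruct c as [z b].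
  pose proof (@identity M (tact (X2, b) (tmul X0 X1))
    (tmul (tact (X2, b) X0) (tact (X2, b) X1)) HM) as H.
  destruct b; apply (fun P => H P (env4 x y z x)); lin_identity.
Qed.

Lemma sact_e {M : str0} (HM : in_LAtri M) c : sact M c (s_e M) = s_e M.
Proof.
  destruct c as [z b]. pose proof (@identity M (tact (X2, b) te) te HM) as H.
  destruct b; apply (fun P => H P (env4 z z z z)); lin_identity.
Qed.

Lemma sact_comm {M : str0} (HM : in_LAtri M) c d (z : M) :
  sact M c (sact M d z) = sact M d (sact M c z).
Proof.
  destruct c as [x b], d as [y b'].
  pose proof (@identity M (tact (X0, b) (tact (X1, b') X2))
    (tact (X1, b') (tact (X0, b) X2)) HM) as H.
  destruct b, b'; apply (fun P => H P (env4 x y z x)); lin_identity.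
Qed.

Lemma sact_idem {M : str0} (HM : in_LAtri M) c (z : M) :
  sact M c (sact M c z) = sact M c z.
Proof.
  destruct c as [x b].
  pose proof (@identity M (tact (X0, b) (tact (X0, b) X2)) (tact (X0, b) X2) HM) as H.
  destruct b; apply (fun P => H P (env4 x x z x)); lin_identity.
Qed.

Lemma sact_split {M : str0} (HM : in_LAtri M) x (z : M) :
  s_mul M (sact M (x, true) z) (sact M (x, false) z) = z.
Proof. apply (rdivK HM). Qed.

Lemma sacts_mul {M : str0} (HM : in_LAtri M) l (x y : M) :
  sacts M l (s_mul M x y) = s_mul M (sacts M l x) (sacts M l y).
Proof.
  induction l as [|c l IH]; simpl; [reflexivity|]. now rewrite IH, sact_mul.
Qed.

Lemma sacts_e {M : str0} (HM : in_LAtri M) l : sacts M l (s_e M) = s_e M.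
Proof. induction l as [|c l IH]; simpl; [reflexivity|]. now rewrite IH, sact_e. Qed.

Lemma sact_sacts {M : str0} (HM : in_LAtri M) c l (z : M) :
  sact M c (sacts M l z) = sacts M l (sact M c z).
Proof.
  induction l as [|d l IH]; simpl; [reflexivity|]. now rewrite sact_comm, IH.
Qed.

Lemma sacts_comm {M : str0} (HM : in_LAtri M) l m (z : M) :
  sacts M l (sacts M m z) = sacts M m (sacts M l z).
Proof.
  induction l as [|d l IH]; simpl; [reflexivity|]. now rewrite IH, sact_sacts.
Qed.

Lemma sacts_app {M : str0} l m (z : M) : sacts M (l ++ m) z = sacts M l (sacts M m z).
Proof. apply fold_right_app. Qed.

Lemma eval_tacts {M : str0} rho l z :
  eval M rho (tacts l z) =
  sacts M (map (fun c => (eval M rho (fst c), snd c)) l) (eval M rho z).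
Proof.
  induction l as [|[t b] l IH]; [reflexivity|]. simpl. rewrite <- IH. now destruct b.
Qed.

(** The predicate [h] is nonnegativity under an assignment in an ordered group, or membership of
    values in a candidate cone. *)
Fixpoint all_hold (h : term L0 -> Prop) (l : list (term L0 * bool)) : Prop :=
  match l with
  | [] => True
  | (t, b) :: l => (if b then h t else ~ h t) /\ all_hold h l
  end.

Definition nonneg {D : oag} (rho : nat -> D) (t : term L0) : Prop :=
  ole ozero (eval (lin_str D) rho t).

(** In an ordered group an action whose sign condition fails is the zero map. It annihilates the
    composite because every action fixes 0. *)
Lemma eval_tacts_lin (D : oag) (rho : nat -> D) l z :
  ~ all_hold (nonneg rho) l -> eval (lin_str D) rho (tacts l z) = ozero.
Proof.
  induction l as [|[t b] l IH]; simpl; [tauto|]. intros H.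
  destruct (classic (all_hold (nonneg rho) l)) as [K|K].
  - assert (N : ~ (if b then nonneg rho t else ~ nonneg rho t)) by tauto.
    unfold nonneg in N. destruct b; simpl.
    + now apply ite_false.
    + rewrite ite_true by tauto. apply oaddN.
  - specialize (IH K). destruct b; simpl; rewrite IH.
    + apply ite_same.
    + rewrite ite_same. apply oaddN.
Qed.

(* [P] stands for the set of elements that are nonnegative in a linearly ordered
   quotient; variable 3 is reserved for the element [a] to be separated. *)
Definition cone {M : str0} (a : M) (P : M -> Prop) : Prop :=
  forall l, (forall (D : oag) (rho : nat -> D), ~ all_hold (nonneg rho) l) ->
  forall x y z : M, ~ all_hold (fun t => P (eval M (env4 x y z a) t)) l.

Definition consistent {M : str0} (a : M) (U : M * bool -> Prop) : Prop :=
  forall l, (forall c, In c l -> U c) -> sacts M l a <> s_e M.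

Lemma maximal_consistent {M : str0} (a : M) : a <> s_e M ->
  exists U, consistent a U /\
    forall c, ~ U c -> ~ consistent a (fun d => U d \/ d = c).
Proof.
  intros Ha.
  destruct (@classical_sets.Zorn_bigcup (M * bool) (consistent a)) as (U & HU & Max).
  - intros F HF Htot l Hl.
    (* The chain may be empty, and then only the empty list has to be considered. For a nonempty
       list, finitely many members of a chain lie below one of them. *)
    destruct (classic (l = [])) as [->|Hne]; [exact Ha|].
    enough (E : exists V, F V /\ forall c, In c l -> V c).
    { destruct E as (V & HV & Hc). exact (HF V HV l Hc). }
    clear Ha. induction l as [|c l IH]; [tauto|].
    destruct (Hl c (or_introl eq_refl)) as [V HV HVc].
    destruct (classic (l = [])) as [->|Hne'].
    + exists V. split; auto. now intros d [<-|[]].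
    + destruct IH as (W & HW & HWl); auto.
      { intros d Hd. apply Hl. now right. }
      destruct (Htot V W HV HW) as [S|S].
      * exists W. split; auto. intros d [<-|Hd]; [exact (S _ HVc)|auto].
      * exists V. split; auto. intros d [<-|Hd]; [auto|exact (S _ (HWl _ Hd))].
  - exists U. split; auto. intros c Hc. apply Max. split.
    + intros d Hd. now left.
    + intros S. apply Hc, S. now right.
Qed.

(** If neither sign of [x] could be added, composites from [U] would annihilate both parts into
    which [x] splits [a]. Their joint composite would then annihilate [a]. *)
Lemma maximal_total {M : str0} (HM : in_LAtri M) (a : M) U : consistent a U ->
  (forall c, ~ U c -> ~ consistent a (fun d => U d \/ d = c)) ->
  forall x, U (x, true) \/ U (x, false).
Proof.
  intros HU Max x.
  assert (K : forall c, ~ U c ->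
    exists l, (forall d, In d l -> U d) /\ sacts M l (sact M c a) = s_e M).
  { intros c Hc. specialize (Max c Hc). apply not_all_ex_not in Max as [l Max].
    apply imply_to_and in Max as [Hl Hla]. apply NNPP in Hla.
    (* By commutation and idempotence, all occurrences of [c] in [l] are absorbed into a single
       application. *)
    enough (E : exists m, (forall d, In d m -> U d) /\
                  sacts M m (sact M c a) = sact M c (sacts M l a)).
    { destruct E as (m & Hm & E). exists m. split; auto. now rewrite E, Hla, sact_e. }
    clear Hla. induction l as [|d l IH].
    - exists []. split; [intros d []|reflexivity].
    - destruct IH as (m & Hm & E). { intros d' Hd'. apply Hl. now right. }
      destruct (Hl d (or_introl eq_refl)) as [Hd| ->].
      + exists (d :: m). split; [now intros d' [<-|Hd']; auto|].
        simpl. now rewrite E, sact_comm.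
      + exists m. split; auto. simpl. now rewrite E, sact_idem. }
  destruct (classic (U (x, true))) as [|N1]; [now left|right]. apply NNPP. intros N2.
  destruct (K _ N1) as (l & Hl & El), (K _ N2) as (m & Hm & Em).
  apply (HU (l ++ m)).
  - intros d Hd. apply in_app_or in Hd as [Hd|Hd]; auto.
  - rewrite <- (sact_split HM x a), sacts_mul, !sacts_app by auto.
    rewrite Em, (sacts_comm HM), El, !sacts_e, mule; auto.
Qed.

(** The cone collects those [x] whose nonnegativity action lies in a maximal consistent [U]. Sign
    conditions contradictory in all ordered groups give an identically zero composite, so they
    cannot all be met by [U]. The same applies to [a] and its inverse: [a] is 0 wherever both are
    nonnegative. *)
Lemma separating_cone {M : str0} (HM : in_LAtri M) (a : M) : a <> s_e M ->
  exists P : M -> Prop, cone a P /\ ~ (P a /\ P (s_rdiv M (s_e M) a)).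
Proof.
  intros Ha. destruct (maximal_consistent Ha) as (U & HU & Max).
  pose proof (maximal_total HM HU Max) as Tot.
  (* A composite that sends [z] to 0 in all ordered groups annihilates [a], so by consistency one of
     its actions is outside [U]. *)
  assert (HU' : forall rho l z, eval M rho z = a ->
    (forall (D : oag) (rho : nat -> D),
       eval (lin_str D) rho (tacts l z) = eval (lin_str D) rho te) ->
    exists c, In c l /\ ~ U (eval M rho (fst c), snd c)).
  { intros rho l z Hz Hl. apply NNPP. intros N.
    apply (HU (map (fun c => (eval M rho (fst c), snd c)) l)).
    - intros c Hc. apply in_map_iff in Hc as (d & <- & Hd). apply NNPP. eauto.
    - rewrite <- Hz, <- eval_tacts. apply (identity _ _ HM Hl). }
  exists (fun x => U (x, true)). split.
  - intros l Hl x y z H.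
    destruct (HU' (env4 x y z a) l X3 eq_refl) as (c & Hc & N).
    { intros D rho. now apply eval_tacts_lin. }
    clear Hl. induction l as [|[t b] l IH]; [destruct Hc|]. destruct H as [Ht Hl].
    destruct Hc as [<-|Hc]; [|now apply IH]. simpl in N.
    destruct b; [tauto|]. destruct (Tot (eval M (env4 x y z a) t)); tauto.
  - intros [H1 H2].
    destruct (HU' (fun _ => a) [(X0, true); (trdiv te X0, true)] X0 eq_refl)
      as (c & [<-|[<-|[]]] & N).
    + intros D rho. simpl. set (x := rho 0).
      unfold ite. destruct (excluded_middle_informative (ole ozero x)); auto.
      destruct (excluded_middle_informative _); auto.
      apply ole_antisym; auto. now apply ole_sub.
    + now apply N.
    + now apply N.
Qed.

(** * Homomorphisms, order quotients and divisible hulls *)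

Definition hom {M N : str0} (h : M -> N) : Prop :=
  (forall x y, h (s_meet M x y) = s_meet N (h x) (h y)) /\
  (forall x y, h (s_join M x y) = s_join N (h x) (h y)) /\
  (forall x y, h (s_mul M x y) = s_mul N (h x) (h y)) /\
  (forall x y, h (s_ldiv M x y) = s_ldiv N (h x) (h y)) /\
  (forall x y, h (s_rdiv M x y) = s_rdiv N (h x) (h y)) /\
  h (s_e M) = s_e N /\ h (s_zero M) = s_zero N /\
  (forall x y, h (s_tri M x y) = s_tri N (h x) (h y)).

(** The group laws are required only up to the equivalence of the preorder. Both the quotient by a
    cone and the group of fractions arise from such data. *)
Record preoag := PreOAG {
  pc :> Type;
  padd : pc -> pc -> pc;
  popp : pc -> pc;
  pzero : pc;
  ple : pc -> pc -> Prop;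
  peqv := fun x y => ple x y /\ ple y x;
  paddA : forall x y z, peqv (padd x (padd y z)) (padd (padd x y) z);
  paddC : forall x y, peqv (padd x y) (padd y x);
  padd0 : forall x, peqv (padd x pzero) x;
  paddN : forall x, peqv (padd x (popp x)) pzero;
  ple_trans : forall x y z, ple x y -> ple y z -> ple x z;
  ple_total : forall x y, ple x y \/ ple y x;
  ple_add : forall x y z, ple x y -> ple (padd x z) (padd y z)
}.

Arguments padd {p}. Arguments popp {p}. Arguments ple {p}. Arguments peqv {p}.
Arguments paddA {p}. Arguments paddC {p}. Arguments padd0 {p}. Arguments paddN {p}.
Arguments ple_trans {p}. Arguments ple_total {p}. Arguments ple_add {p}.

Lemma preoag_quotient (Q : preoag) : exists (D : oag) (pi : Q -> D),
  (forall d, exists x, pi x = d) /\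
  (forall x y, pi (padd x y) = oadd (pi x) (pi y)) /\
  (forall x y, ole (pi x) (pi y) <-> ple x y).
Proof.
  (* Classes are represented by the predicates [peqv a], which extensionality makes equal for
     equivalent elements. *)
  set (B := {X : Q -> Prop | exists a, X = peqv a}).
  set (cls := fun a : Q => exist _ (peqv a) (ex_intro _ a eq_refl) : B).
  assert (Hrep : forall X : B, exists a, cls a = X).
  { intros [X [a ->]]. now exists a. }
  set (rep := fun X => proj1_sig (constructive_indefinite_description _ (Hrep X))).
  assert (clsK : forall X, cls (rep X) = X).
  { intros X. apply (proj2_sig (constructive_indefinite_description _ (Hrep X))). }
  assert (eqv_refl : forall a : Q, peqv a a).
  { intros a. split; destruct (ple_total a a); auto. }
  assert (cls_eq : forall a b, cls a = cls b <-> peqv a b).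
  { intros a b. split.
    - intros E. apply (f_equal (@proj1_sig _ _)) in E. simpl in E. rewrite E.
      apply eqv_refl.
    - intros [H1 H2]. apply eq_sig_hprop; [intros; apply proof_irrelevance|]. simpl.
      apply functional_extensionality. intros c. apply propositional_extensionality.
      split; intros [K1 K2]; split; eauto using ple_trans. }
  assert (repK : forall a, peqv (rep (cls a)) a) by (intros; apply cls_eq, clsK).
  assert (add_eq : forall a b, cls (padd (rep (cls a)) (rep (cls b))) = cls (padd a b)).
  { assert (L : forall a a' b, peqv a a' -> cls (padd a b) = cls (padd a' b)).
    { intros a a' b [H1 H2]. apply cls_eq. split; now apply ple_add. }
    intros a b. rewrite (L _ a) by apply repK.
    rewrite (proj2 (cls_eq _ _) (paddC a _)), (L _ b) by apply repK.
    apply cls_eq, paddC. }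
  assert (le_eq : forall a b, ple (rep (cls a)) (rep (cls b)) <-> ple a b).
  { intros a b. destruct (repK a), (repK b). split; eauto using ple_trans. }
  unshelve refine (ex_intro _ (@OAG B (fun X Y => cls (padd (rep X) (rep Y)))
    (fun X => cls (popp (rep X))) (cls (pzero Q)) (fun X Y => ple (rep X) (rep Y))
    _ _ _ _ _ _ _ _) (ex_intro _ cls _)); simpl.
  - intros X Y Z. destruct (Hrep X) as [a <-], (Hrep Y) as [b <-], (Hrep Z) as [c <-].
    rewrite (add_eq b c), (add_eq a b), !add_eq. apply cls_eq, paddA.
  - intros X Y. apply cls_eq, paddC.
  - intros X. destruct (Hrep X) as [a <-]. rewrite add_eq. apply cls_eq, padd0.
  - intros X. transitivity (cls (padd (rep X) (popp (rep X)))); [|apply cls_eq, paddN].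
    rewrite <- (add_eq (rep X) (popp (rep X))). now rewrite clsK.
  - intros X Y H K. rewrite <- (clsK X), <- (clsK Y). now apply cls_eq.
  - intros X Y Z. apply ple_trans.
  - intros X Y. apply ple_total.
  - intros X Y Z H. apply le_eq. now apply ple_add.
  - split; [|split].
    + intros X. exists (rep X). apply clsK.
    + intros x y. now rewrite add_eq.
    + apply le_eq.
Qed.

Lemma ole_zmul {D : oag} p (x y : D) : (0 < p)%Z -> ole (zmul p x) (zmul p y) <-> ole x y.
Proof.
  intros Hp. rewrite <- (ole_sub x y), <- (ole_sub (zmul p x)).
  pose proof (pos_zmul false (oadd y (oopp x)) Hp) as H. unfold pos in H. rewrite <- H.
  replace (oadd (zmul p y) (oopp (zmul p x))) with (zmul p (oadd y (oopp x))) by grp.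
  tauto.
Qed.

(* The pair [(x, p)] stands for the fraction [x / p]. *)
Definition fractions (L : oag) : preoag.
Proof.
  unshelve refine (@PreOAG (L * positive)
    (fun a b => (oadd (zmul (Zpos (snd b)) (fst a)) (zmul (Zpos (snd a)) (fst b)),
                 (snd a * snd b)%positive))
    (fun a => (oopp (fst a), snd a)) (ozero, 1%positive)
    (fun a b => ole (zmul (Zpos (snd b)) (fst a)) (zmul (Zpos (snd a)) (fst b)))
    _ _ _ _ _ _ _).
  1-4: intros; cbn [fst snd]; rewrite ?Pos2Z.inj_mul;
    match goal with |- ole ?a ?b /\ _ =>
      let E := fresh in assert (E : a = b) by grp; rewrite E end;
    split; apply ole_refl.
  - intros [x p] [y q] [z r]. cbn [fst snd]. intros H K.
    apply (ole_zmul (p := Zpos q)); [lia|].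
    apply (ole_zmul (p := Zpos r)) in H; [|lia]. apply (ole_zmul (p := Zpos p)) in K; [|lia].
    replace (zmul (Zpos q) (zmul (Zpos r) x)) with (zmul (Zpos r) (zmul (Zpos q) x)) by grp.
    apply ole_trans with (1 := H).
    replace (zmul (Zpos r) (zmul (Zpos p) y)) with (zmul (Zpos p) (zmul (Zpos r) y)) by grp.
    apply ole_trans with (1 := K).
    replace (zmul (Zpos p) (zmul (Zpos q) z)) with (zmul (Zpos q) (zmul (Zpos p) z)) by grp.
    apply ole_refl.
  - intros a b. apply ole_total.
  - intros [x p] [y q] [z r]. cbn [fst snd]. intros H. rewrite !Pos2Z.inj_mul.
    apply (ole_zmul (p := (Zpos r * Zpos r)%Z)) in H; [|lia].
    apply (ole_add _ _ (zmul (Zpos p * Zpos q * Zpos r) z)) in H.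
    replace (zmul (Zpos q * Zpos r) _) with
      (oadd (zmul (Zpos r * Zpos r) (zmul (Zpos q) x)) (zmul (Zpos p * Zpos q * Zpos r) z))
      by grp.
    replace (zmul (Zpos p * Zpos r) _) with
      (oadd (zmul (Zpos r * Zpos r) (zmul (Zpos p) y)) (zmul (Zpos p * Zpos q * Zpos r) z))
      by grp.
    exact H.
Defined.

Lemma divisible_hull (L : oag) : (exists x : L, x <> ozero) ->
  exists (D : oag) (iota : L -> D), doag D /\
    (forall x y, iota (oadd x y) = oadd (iota x) (iota y)) /\
    (forall x y, ole (iota x) (iota y) <-> ole x y).
Proof.
  intros [x0 Hx0]. destruct (preoag_quotient (fractions L)) as (D & pi & Sur & Add & Le).
  assert (Eq : forall x p y q, zmul (Zpos q) x = zmul (Zpos p) y ->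
    pi (x, p) = pi (y, q)).
  { intros x p y q E. apply ole_antisym; apply Le; cbn [ple fractions fst snd];
      rewrite E; apply ole_refl. }
  exists D, (fun x => pi (x, 1%positive)).
  assert (AddL : forall x y, pi (oadd x y, 1%positive) = oadd (pi (x, 1%positive)) (pi (y, 1%positive))).
  { intros x y. rewrite <- Add. cbn [padd fractions fst snd]. apply Eq. grp. }
  assert (LeL : forall x y, ole (pi (x, 1%positive)) (pi (y, 1%positive)) <-> ole x y).
  { intros x y. rewrite Le. cbn [ple fractions fst snd]. now rewrite !zmul_1. }
  split; [|auto].
  assert (pi0 : forall p, pi (ozero, p) = ozero).
  { intros p. apply oadd_cancel with (z := pi (ozero, p)).
    rewrite <- Add, oadd0l. cbn [padd fractions fst snd]. apply Eq. grp. }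
  split.
  - exists (pi (x0, 1%positive)). intros H. apply Hx0.
    rewrite <- (pi0 1%positive) in H.
    apply ole_antisym; apply LeL; rewrite H; apply ole_refl.
  - intros n d. destruct (Sur d) as [[x p] <-].
    (* Division by [n + 1] multiplies the denominator by [n + 1]. *)
    exists (pi (x, (p * Pos.of_succ_nat n)%positive)).
    set (q := (p * Pos.of_succ_nat n)%positive).
    assert (E : forall m, nmul m (pi (x, q)) = pi (nmul m x, q)).
    { induction m as [|m IH]; simpl; [now rewrite pi0|].
      rewrite IH, <- Add. cbn [padd fractions fst snd]. apply Eq.
      rewrite Pos2Z.inj_mul. grp. }
    rewrite E. apply Eq. rewrite <- zmul_nat. unfold q.
    rewrite Pos2Z.inj_mul.
    replace (Z.of_nat (S n)) with (Zpos (Pos.of_succ_nat n)) by lia. grp.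
Qed.

Definition int_oag : oag.
Proof.
  refine (@OAG Z Z.add Z.opp 0%Z Z.le _ _ _ _ _ _ _ _); intros; lia.
Defined.

Lemma doag_exists : exists D : oag, doag D.
Proof.
  destruct (@divisible_hull int_oag) as (D & _ & HD & _); [|eauto].
  now exists 1%Z.
Qed.

(** Adding the negated conclusion to [l] produces conditions contradictory in every ordered group,
    which a cone cannot satisfy. *)
Lemma cone_implies {M : str0} (a : M) (P : M -> Prop) l t : cone a P ->
  (forall (D : oag) (rho : nat -> D), all_hold (nonneg rho) l -> nonneg rho t) ->
  forall x y z, all_hold (fun s => P (eval M (env4 x y z a) s)) l ->
    P (eval M (env4 x y z a) t).
Proof.
  intros HP H x y z Hl. apply NNPP. intros N.
  apply (HP ((t, false) :: l)) with x y z.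
  - intros D rho [K Kl]. exact (K (H D rho Kl)).
  - now split.
Qed.

Lemma nonneg_rdiv {D : oag} (rho : nat -> D) s t :
  nonneg rho (trdiv t s) <-> ole (eval (lin_str D) rho s) (eval (lin_str D) rho t).
Proof. apply ole_sub. Qed.

(** [P] induces the preorder in which [x] is below [y] when [y - x] lies in [P]. Its order axioms
    are statements about signs valid in ordered groups, so the cone inherits them. *)
Lemma cone_group {M : str0} (HM : in_LAtri M) (a : M) (P : M -> Prop) : cone a P ->
  exists (L : oag) (f : M -> L),
    (forall x y, f (s_mul M x y) = oadd (f x) (f y)) /\
    (forall x y, ole (f x) (f y) <-> P (s_rdiv M y x)).
Proof.
  intros HP.
  assert (Tot : forall x y, P (s_rdiv M y x) \/ P (s_rdiv M x y)).
  { intros x y. apply NNPP. intros N.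
    apply (HP [(trdiv X1 X0, false); (trdiv X0 X1, false)]) with x y x; [|simpl; tauto].
    intros D rho. cbn [all_hold]. rewrite !nonneg_rdiv. simpl.
    pose proof (ole_total (rho 0) (rho 1)). tauto. }
  assert (Eqv : forall x y, x = y -> P (s_rdiv M y x) /\ P (s_rdiv M x y)).
  { intros x y <-. pose proof (Tot x x). tauto. }
  unshelve epose (Q := @PreOAG M (s_mul M) (s_rdiv M (s_e M)) (s_e M)
    (fun x y => P (s_rdiv M y x)) _ _ _ _ _ Tot _).
  - intros x y z. apply Eqv, (mulA HM).
  - intros x y. apply Eqv, (mulC HM).
  - intros x. apply Eqv, (mule HM).
  - intros x. apply Eqv, (rdivK HM).
  - intros x y z Hxy Hyz. apply (@cone_implies M a P
      [(trdiv X1 X0, true); (trdiv X2 X1, true)] (trdiv X2 X0) HP) with (x := x) (y := y) (z := z);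
      [|simpl; auto].
    intros D rho. cbn [all_hold]. rewrite !nonneg_rdiv. intros (H1 & H2 & _).
    eapply ole_trans; eassumption.
  - intros x y z Hxy. apply (@cone_implies M a P
      [(trdiv X1 X0, true)] (trdiv (tmul X1 X2) (tmul X0 X2)) HP) with (x := x) (y := y) (z := z);
      [|simpl; auto].
    intros D rho. cbn [all_hold]. rewrite !nonneg_rdiv. intros (H1 & _).
    now apply ole_add.
  - destruct (preoag_quotient Q) as (L & f & _ & Add & Le). now exists L, f.
Qed.

(** Once the relevant sign is decided, each piecewise operation equals one of its branches.
    Surjectivity of [f] is not assumed, so [f] may end in the divisible hull of the quotient. *)
Lemma cone_hom {M : str0} (HM : in_LAtri M) (a : M) (P : M -> Prop) (D : oag) (f : M -> D) :
  cone a P ->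
  (forall x y, f (s_mul M x y) = oadd (f x) (f y)) ->
  (forall x y, ole (f x) (f y) <-> P (s_rdiv M y x)) ->
  @hom M (lin_str D) f.
Proof.
  intros HP Add Le.
  (* Equations that hold in ordered groups under sign conditions hold after [f], as two inequalities
     supplied by the cone. *)
  assert (E : forall l s t,
    (forall (D : oag) (rho : nat -> D), all_hold (nonneg rho) l ->
       eval (lin_str D) rho s = eval (lin_str D) rho t) ->
    forall x y, all_hold (fun t => P (eval M (env4 x y x a) t)) l ->
       f (eval M (env4 x y x a) s) = f (eval M (env4 x y x a) t)).
  { intros l s t H x y Hl. apply ole_antisym; apply Le.
    - apply (@cone_implies M a P l (trdiv t s) HP); auto.
      intros D' rho K. rewrite nonneg_rdiv, (H D' rho K). apply ole_refl.
    - apply (@cone_implies M a P l (trdiv s t) HP); auto.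
      intros D' rho K. rewrite nonneg_rdiv, (H D' rho K). apply ole_refl. }
  assert (f0 : f (s_e M) = ozero).
  { apply oadd_cancel with (z := f (s_e M)). now rewrite <- Add, mule, oadd0l. }
  assert (Pf : forall x, ole ozero (f x) <-> P x).
  { intros x. rewrite <- f0, Le.
    replace (s_rdiv M x (s_e M)) with x; [tauto|].
    rewrite <- (mule HM (s_rdiv M x (s_e M))), (mulC HM). symmetry. apply (rdivK HM). }
  split; [|split; [|split; [|split; [|split; [|split; [|split]]]]]]; simpl.
  - intros x y. destruct (classic (ole (f x) (f y))) as [H|H];
      [rewrite ite_true by exact H | rewrite ite_false by exact H]; rewrite Le in H.
    + apply (E [(trdiv X1 X0, true)] (tmeet X0 X1) X0) with (x := x) (y := y); [|simpl; auto].
      intros D' rho [K _]. rewrite nonneg_rdiv in K. now apply ite_true.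
    + apply (E [(trdiv X1 X0, false)] (tmeet X0 X1) X1) with (x := x) (y := y); [|simpl; auto].
      intros D' rho [K _]. rewrite nonneg_rdiv in K. now apply ite_false.
  - intros x y. destruct (classic (ole (f x) (f y))) as [H|H];
      [rewrite ite_true by exact H | rewrite ite_false by exact H]; rewrite Le in H.
    + apply (E [(trdiv X1 X0, true)] (tjoin X0 X1) X1) with (x := x) (y := y); [|simpl; auto].
      intros D' rho [K _]. rewrite nonneg_rdiv in K. now apply ite_true.
    + apply (E [(trdiv X1 X0, false)] (tjoin X0 X1) X0) with (x := x) (y := y); [|simpl; auto].
      intros D' rho [K _]. rewrite nonneg_rdiv in K. now apply ite_false.
  - exact Add.
  - intros x y. transitivity (f (s_mul M x (s_ldiv M x y)) - f x)%G.
    + rewrite Add. grp.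
    + now rewrite ldivK.
  - intros x y. transitivity (f (s_mul M y (s_rdiv M x y)) - f y)%G.
    + rewrite Add. grp.
    + now rewrite rdivK.
  - exact f0.
  - now rewrite zero_e.
  - intros x y. destruct (classic (ole ozero (f x))) as [H|H];
      [rewrite ite_true by exact H | rewrite ite_false by exact H]; rewrite Pf in H.
    + apply (E [(X0, true)] (ttri X0 X1) X1) with (x := x) (y := y); [|simpl; auto].
      intros D' rho [K _]. now apply ite_true.
    + rewrite <- f0.
      apply (E [(X0, false)] (ttri X0 X1) te) with (x := x) (y := y); [|simpl; auto].
      intros D' rho [K _]. now apply ite_false.
Qed.

(** The case [a = s_e M], where the zero map suffices, is included so that a family indexed by all
    of [M] can be chosen. *)
Lemma separating_hom {M : str0} (HM : in_LAtri M) (a : M) :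
  exists F : {D : oag & M -> D},
    doag (projT1 F) /\ @hom M (lin_str (projT1 F)) (projT2 F) /\
    (a <> s_e M -> projT2 F a <> ozero).
Proof.
  destruct (classic (a = s_e M)) as [->|Ha].
  - destruct doag_exists as [D HD]. exists (existT _ D (fun _ => ozero)). simpl.
    split; [exact HD|]. split; [|tauto].
    split; [|split; [|split; [|split; [|split; [|split; [|split]]]]]]; simpl;
      intros; rewrite ?ite_same; auto; grp.
  - destruct (separating_cone HM Ha) as (P & HP & HPa).
    destruct (cone_group HM HP) as (L & f & Add & Le).
    assert (Hfa : f a <> f (s_e M)).
    { intros E. apply HPa.
      assert (E' : s_rdiv M a (s_e M) = a).
      { rewrite <- (mule HM (s_rdiv M a (s_e M))), (mulC HM). apply (rdivK HM). }
      rewrite <- E' at 1. rewrite <- !Le, E. split; apply ole_refl. }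
    assert (f0 : f (s_e M) = ozero).
    { apply oadd_cancel with (z := f (s_e M)). now rewrite <- Add, mule, oadd0l. }
    rewrite f0 in Hfa.
    destruct (@divisible_hull L) as (D & iota & HD & Addi & Lei); [now exists (f a)|].
    exists (existT _ D (fun x => iota (f x))). simpl. split; [exact HD|].
    assert (Hom : @hom M (lin_str D) (fun x => iota (f x))).
    { apply (@cone_hom M HM a P D _ HP).
      - intros x y. now rewrite Add, Addi.
      - intros x y. now rewrite Lei, Le. }
    split; [exact Hom|]. intros _ E. apply Hfa.
    assert (E0 : iota (f (s_e M)) = ozero) by apply Hom.
    rewrite <- f0. apply ole_antisym; apply Lei; rewrite E, E0; apply ole_refl.
Qed.

Lemma embedding_in_sections {M : str0} (HM : in_LAtri M) :
  exists (D : M -> oag) (h : M -> sections D),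
    (forall i, doag (D i)) /\ @embedding M (sec_str D) h.
Proof.
  destruct (choice _ (separating_hom HM)) as [F HF].
  set (D := fun i => projT1 (F i)).
  set (pi := fun i => projT2 (F i) : M -> D i).
  assert (Hom : forall i, @hom M (lin_str (D i)) (pi i)) by (intros i; apply HF).
  (* Sections vanish at 0, so the image of [x] is placed at odd [n] and 0 at even [n], with period
     2. *)
  unshelve epose (h := fun x => @Sections M D
    (fun n i => if Nat.odd n then pi i x else ozero) _ _).
  - exists 2. split; [lia|]. intros n i. now rewrite Nat.odd_add, Bool.xorb_false_r.
  - reflexivity.
  - exists D, h. split; [intros i; apply HF|]. split.
    + intros x y E.
      (* Otherwise the component indexed by this very difference would separate [x] from [y]. *)
      assert (E' : s_rdiv M x y = s_e M).
      { apply NNPP. intros N. apply (proj2 (proj2 (HF _)) N).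
        destruct (Hom (s_rdiv M x y)) as (_ & _ & _ & _ & Hdiv & _).
        unfold pi in Hdiv. rewrite Hdiv.
        apply (f_equal (fun f : sections D => f 1 (s_rdiv M x y))) in E.
        change (pi (s_rdiv M x y) x = pi (s_rdiv M x y) y) in E.
        unfold pi in E. rewrite E. apply oaddN. }
      rewrite <- (rdivK HM x y), E'. apply mule, HM.
    + split; [|split; [|split; [|split; [|split; [|split; [|split]]]]]]; intros;
        apply sec_ext; intros n i; destruct (Hom i) as (H1 & H2 & H3 & H4 & H5 & H6 & H7 & H8);
        simpl in *; destruct (Nat.odd n); rewrite ?ite_same; auto; grp.
Qed.

(** * The model completion *)

Lemma sec_in_LAtri (I : Type) (D : I -> oag) : in_LAtri (sec_str D).
Proof.
  intros s t H rho. apply eval_eq_at. intros n i. apply H, lin_str_linear.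
Qed.

Lemma models_Th_in_LAtri (M : str0) : models Th_LAtri M -> in_LAtri M.
Proof.
  intros HM s t H. destruct (closed_form (feq s t)) as (q & Hq & E).
  apply E. apply HM. split; [exact Hq|]. intros S HS. apply E. now apply HS.
Qed.

Definition Th_sections : theory L0 :=
  fun p => sentence p /\ forall w : secworld, sat (sec_str (sw_oag w)) (sw_env w) p.

Lemma sec_models (I : Type) (D : I -> oag) (i : I) :
  (forall i, doag (D i)) -> models Th_sections (sec_str D).
Proof. intros HD p [_ Hp] rho. apply (Hp (SecWorld i HD rho)). Qed.

Lemma Th_sections_open (p : formula L0) :
  (forall w : secworld, sat (sec_str (sw_oag w)) (sw_env w) p) ->
  entails Th_sections p.
Proof.
  intros H. destruct (closed_form p) as (q & Hq & E). intros S HS. apply E.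
  apply HS. split; [exact Hq|]. intros [I D i HD rho]. simpl.
  revert rho. apply (E (sec_str D)). intros rho. apply (H (SecWorld i HD rho)).
Qed.

(** The equivalence of [p] with its eliminated form is valid in all algebras of sections, hence in
    all models of their theory. *)
Lemma Th_sections_qe (p : formula L0) : exists q, qfree q /\
  forall S, models Th_sections S -> forall rho, sat S rho p <-> sat S rho q.
Proof.
  destruct (sections_qe p) as (q & Hq & E). exists q. split; [exact Hq|].
  intros S HS rho. apply (Th_sections_open (fand (fimp p q) (fimp q p))); [|exact HS].
  intros w. apply E.
Qed.

Lemma embedding_eval {M N : str0} (h : M -> N) : embedding h ->
  forall rho t, h (eval M rho t) = eval N (fun n => h (rho n)) t.
Proof.
  intros (_ & H1 & H2 & H3 & H4 & H5 & H6 & H7 & H8) rho t.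
  induction t; simpl; rewrite <- ?IHt1, <- ?IHt2; auto. destruct c.
Qed.

Lemma embedding_qfree {M N : str0} (h : M -> N) : embedding h ->
  forall q, qfree q -> forall rho, sat M rho q <-> sat N (fun n => h (rho n)) q.
Proof.
  intros Hh q. induction q; simpl; intros Hq rho; try tauto.
  - rewrite <- !(embedding_eval Hh). split; [congruence|apply Hh].
  - rewrite IHq1, IHq2 by tauto. tauto.
  - rewrite IHq1, IHq2 by tauto. tauto.
  - rewrite IHq1, IHq2 by tauto. tauto.
Qed.

Lemma embedding_universal {M N : str0} (h : M -> N) : embedding h ->
  forall p, universal p -> forall rho, sat N (fun n => h (rho n)) p -> sat M rho p.
Proof.
  intros Hh p Hp. induction Hp as [p Hp|n p Hp IH]; intros rho.
  - now apply embedding_qfree.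
  - intros H x. apply IH. rewrite upd_map. apply H.
Qed.

Lemma Th_sections_model_complete : model_complete Th_sections.
Proof.
  intros M N h HM HN Hh p rho. destruct (Th_sections_qe p) as (q & Hq & E).
  rewrite (E M HM), (E N HN). now apply embedding_qfree.
Qed.

Lemma embedding_in_model (M : str0) : models Th_LAtri M ->
  exists (N : str0) (h : M -> N), models Th_sections N /\ embedding h.
Proof.
  intros HM. destruct (embedding_in_sections (models_Th_in_LAtri HM)) as (D & h & HD & Hh).
  exists (sec_str D), h. split; [exact (@sec_models M D (s_e M) HD)|exact Hh].
Qed.

(** Algebras of sections lie in the variety; conversely, every model of [Th_LAtri] embeds in a model
    of [Th_sections], and universal formulas pass to subalgebras. *)
Lemma Th_sections_universal (p : formula L0) : sentence p -> universal p ->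
  (entails Th_LAtri p <-> entails Th_sections p).
Proof.
  intros Hs Hu. split; intros H.
  - apply Th_sections_open. intros w. apply H. intros q [_ Hq].
    apply Hq, sec_in_LAtri.
  - intros M HM rho. destruct (embedding_in_model HM) as (N & h & HN & Hh).
    apply (embedding_universal Hh Hu). now apply H.
Qed.

(** * Diagrams and completeness *)

Definition reduct (C : Type) (S : structure C) : str0 :=
  @Structure L0 S (s_meet S) (s_join S) (s_mul S) (s_ldiv S) (s_rdiv S) (s_e S)
    (s_zero S) (s_tri S) (fun c => match c with end).

Lemma sat_lift (C : Type) (S : structure C) (f : L0 -> C) (p : formula L0) :
  forall rho, sat S rho (map_formula f p) <-> sat (reduct S) rho p.
Proof.
  assert (E : forall rho t, eval S rho (map_term f t) = eval (reduct S) rho t).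
  { intros rho t. induction t; simpl; rewrite ?IHt1, ?IHt2; auto. destruct c. }
  induction p; simpl; intros rho; rewrite ?E, ?IHp1, ?IHp2; try tauto.
  - split; intros H x; apply IHp, H.
  - split; intros [x H]; exists x; apply IHp, H.
Qed.

Definition with_constants (N : str0) (C : Type) (h : C -> N) : structure C :=
  @Structure C N (s_meet N) (s_join N) (s_mul N) (s_ldiv N) (s_rdiv N) (s_e N)
    (s_zero N) (s_tri N) h.

Lemma reduct_with_constants (N : str0) (C : Type) (h : C -> N) :
  reduct (with_constants N h) = N.
Proof.
  destruct N. unfold reduct, with_constants. simpl. f_equal.
  apply functional_extensionality. intros [].
Qed.

Fixpoint tconsts (C : Type) (t : term C) : list C :=
  match t with
  | tcst c => [c]
  | tvar _ | te | tzero => []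
  | tmeet a b | tjoin a b | tmul a b | tldiv a b | trdiv a b | ttri a b =>
      tconsts a ++ tconsts b
  end.

Fixpoint fconsts (C : Type) (p : formula C) : list C :=
  match p with
  | fbot => []
  | feq s t => tconsts s ++ tconsts t
  | fimp a b | fand a b | for_ a b => fconsts a ++ fconsts b
  | fall _ a | fex _ a => fconsts a
  end.

(* Even variables are the old ones, odd variables replace the constants. *)
Fixpoint tuncst (C : Type) (g : C -> nat) (t : term C) : term L0 :=
  match t with
  | tvar n => tvar (2 * n)
  | tcst c => tvar (2 * g c + 1)
  | tmeet a b => tmeet (tuncst g a) (tuncst g b)
  | tjoin a b => tjoin (tuncst g a) (tuncst g b)
  | tmul a b => tmul (tuncst g a) (tuncst g b)
  | tldiv a b => tldiv (tuncst g a) (tuncst g b)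
  | trdiv a b => trdiv (tuncst g a) (tuncst g b)
  | te => te
  | tzero => tzero
  | ttri a b => ttri (tuncst g a) (tuncst g b)
  end.

Fixpoint funcst (C : Type) (g : C -> nat) (p : formula C) : formula L0 :=
  match p with
  | fbot => fbot
  | feq s t => feq (tuncst g s) (tuncst g t)
  | fimp a b => fimp (funcst g a) (funcst g b)
  | fand a b => fand (funcst g a) (funcst g b)
  | for_ a b => for_ (funcst g a) (funcst g b)
  | fall n a => fall (2 * n) (funcst g a)
  | fex n a => fex (2 * n) (funcst g a)
  end.

Definition interleave (A : Type) (f g : nat -> A) (n : nat) : A :=
  if Nat.even n then f (Nat.div2 n) else g (Nat.div2 n).

Lemma interleave_even (A : Type) (f g : nat -> A) n : interleave f g (2 * n) = f n.
Proof. unfold interleave. now rewrite Nat.even_even, Nat.div2_double. Qed.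

Lemma interleave_odd (A : Type) (f g : nat -> A) n : interleave f g (2 * n + 1) = g n.
Proof.
  unfold interleave. now rewrite Nat.even_odd, Nat.add_1_r, Nat.div2_succ_double.
Qed.

Lemma interleave_upd (A : Type) (f g : nat -> A) n a :
  interleave (upd f n a) g = upd (interleave f g) (2 * n) a.
Proof.
  apply functional_extensionality. intros m.
  destruct (Nat.Even_or_Odd m) as [[k ->]|[k ->]].
  - rewrite interleave_even. unfold upd. rewrite interleave_even.
    destruct (Nat.eqb_spec k n), (Nat.eqb_spec (2 * k) (2 * n)); auto; lia.
  - rewrite upd_other by lia. now rewrite !interleave_odd.
Qed.

Lemma eval_tuncst (C : Type) (S : structure C) (g : C -> nat) (s : nat -> S) rho t :
  (forall c, In c (tconsts t) -> s (g c) = s_cst S c) ->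
  eval S rho t = eval (reduct S) (interleave rho s) (tuncst g t).
Proof.
  induction t; cbn [tconsts tuncst eval]; intros H;
    try (rewrite IHt1, IHt2 by (intros; apply H, in_or_app; auto)); auto.
  - now rewrite interleave_even.
  - rewrite interleave_odd. symmetry. apply H. now left.
Qed.

Lemma sat_funcst (C : Type) (S : structure C) (g : C -> nat) (s : nat -> S) p :
  (forall c, In c (fconsts p) -> s (g c) = s_cst S c) -> forall rho,
  sat S rho p <-> sat (reduct S) (interleave rho s) (funcst g p).
Proof.
  induction p; cbn [fconsts funcst sat]; intros H rho;
    try (rewrite IHp1, IHp2 by (intros; apply H, in_or_app; auto)); try tauto.
  - rewrite !(@eval_tuncst _ S g s rho) by (intros; apply H, in_or_app; auto). tauto.
  - split; intros K x; specialize (K x).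
    + rewrite <- (interleave_upd rho s). now apply IHp.
    + apply IHp; [exact H|]. now rewrite interleave_upd.
  - split; intros [x K]; exists x.
    + rewrite <- (interleave_upd rho s). now apply IHp.
    + apply IHp; [exact H|]. now rewrite interleave_upd.
Qed.

Fixpoint tclosed (C : Type) (e : nat -> C) (t : term L0) : term C :=
  match t with
  | tvar n => tcst (e n)
  | tcst c => match c with end
  | tmeet a b => tmeet (tclosed e a) (tclosed e b)
  | tjoin a b => tjoin (tclosed e a) (tclosed e b)
  | tmul a b => tmul (tclosed e a) (tclosed e b)
  | tldiv a b => tldiv (tclosed e a) (tclosed e b)
  | trdiv a b => trdiv (tclosed e a) (tclosed e b)
  | te => te
  | tzero => tzero
  | ttri a b => ttri (tclosed e a) (tclosed e b)
  end.

Lemma tfree_tclosed (C : Type) (e : nat -> C) t n : ~ tfree n (tclosed e t).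
Proof. induction t; simpl; try tauto. destruct c. Qed.

Lemma eval_tclosed (C : Type) (S : structure C) (e : nat -> C) rho t :
  eval S rho (tclosed e t) = eval (reduct S) (fun n => s_cst S (e n)) t.
Proof. induction t; simpl; rewrite ?IHt1, ?IHt2; auto. destruct c. Qed.

Lemma eval_reduct_expand (M : str0) rho t :
  eval (reduct (expand M)) rho t = eval M rho t.
Proof. induction t; simpl; rewrite ?IHt1, ?IHt2; auto. destruct c. Qed.

(** After instantiation by constants, each atom or its negation belongs to the diagram, whichever is
    true in [M]; connectives follow by induction. *)
Lemma diagram_qfree (M : str0) (S : structure M) : models (diagram M) S ->
  forall q, qfree q -> forall e : nat -> M,
    sat (reduct S) (fun n => s_cst S (e n)) q <-> sat M e q.
Proof.
  intros HS q. induction q; simpl; intros Hq e; try tauto.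
  - set (p := feq (tclosed e t) (tclosed e t0)).
    assert (Hp : sentence p).
    { intros n [H|H]; now apply tfree_tclosed in H. }
    assert (HM : forall rho, sat (expand M) rho p <-> eval M e t = eval M e t0).
    { intros rho. simpl. rewrite !eval_tclosed.
      rewrite <- !(eval_reduct_expand M). simpl. tauto. }
    assert (HSp : forall rho, sat S rho p <->
      eval (reduct S) (fun n => s_cst S (e n)) t =
      eval (reduct S) (fun n => s_cst S (e n)) t0).
    { intros rho. simpl. now rewrite !eval_tclosed. }
    rewrite <- (HSp (fun _ => s_e S)). split.
    + intros H. apply NNPP. intros N. revert H.
      apply (HS (fnot p)). split; [|split].
      * intros n [H|H]; [now apply Hp in H|exact H].
      * right. now exists (tclosed e t), (tclosed e t0).
      * intros rho H. now apply N, (HM rho).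
    + intros H. apply HS. split; [exact Hp|]. split.
      * left. now exists (tclosed e t), (tclosed e t0).
      * intros rho. now apply HM.
  - rewrite IHq1, IHq2 by tauto. tauto.
  - rewrite IHq1, IHq2 by tauto. tauto.
  - rewrite IHq1, IHq2 by tauto. tauto.
Qed.

Lemma diagram_consistent (M N : str0) (h : M -> N) : embedding h ->
  models (diagram M) (with_constants N h).
Proof.
  intros Hh p (Hs & Hl & HM) rho.
  assert (E : forall t, (forall n, ~ tfree n t) -> forall rho',
    eval (with_constants N h) rho t = h (eval (expand M) rho' t)).
  { destruct Hh as (_ & H1 & H2 & H3 & H4 & H5 & H6 & H7 & H8).
    intros t Ht rho'.
    induction t; simpl; simpl in Ht;
      try rewrite IHt1, IHt2 by firstorder; auto.
    destruct (Ht n eq_refl). }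
  destruct Hl as [(s & t & ->)|(s & t & ->)].
  - simpl. rewrite (E s) with (rho' := fun _ => s_e M) by firstorder.
    rewrite (E t) with (rho' := fun _ => s_e M) by firstorder.
    f_equal. apply (HM (fun _ => s_e M)).
  - simpl. rewrite (E s) with (rho' := fun _ => s_e M) by firstorder.
    rewrite (E t) with (rho' := fun _ => s_e M) by firstorder.
    intros H. apply (HM (fun _ => s_e M)). simpl. now apply Hh.
Qed.

(** Constants of [p] are traded for variables and the quantifiers are eliminated. The truth of the
    result at the named elements is fixed by the diagram, so it is the same in all models. *)
Lemma Th_sections_diagram_complete (M : str0) : models Th_LAtri M ->
  complete (union (@lift_theory M Th_sections) (diagram M)).
Proof.
  intros HM. split.
  - destruct (embedding_in_model HM) as (N & h & HN & Hh).
    exists (with_constants N h). intros p [(q & Hq & ->)|Hp].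
    + intros rho. apply sat_lift. revert rho.
      change (forall rho : nat -> reduct (with_constants N h),
        sat (reduct (with_constants N h)) rho q).
      rewrite reduct_with_constants. now apply HN.
    + now apply diagram_consistent.
  - intros p Hp.
    set (l := fconsts p).
    (* A constant of [p] is numbered by a position at which it occurs in [l]. *)
    destruct (choice (fun c n => In c l -> nth n l (s_e M) = c)) as [g Hg].
    { intros c. destruct (classic (In c l)) as [Hc|Hc]; [|exists 0; tauto].
      destruct (In_nth l c (s_e M) Hc) as (n & _ & Hn). now exists n. }
    destruct (Th_sections_qe (funcst g p)) as (q & Hq & E).
    (* Odd variables carry the constants. Even ones receive a default value, harmless because [p] is
       a sentence. *)
    set (e := interleave (fun _ => s_e M) (fun k => nth k l (s_e M))).
    assert (K : forall S, models (union (@lift_theory M Th_sections) (diagram M)) S ->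
      forall rho, sat S rho p <-> sat M e q).
    { intros S HS rho.
      assert (HS' : models Th_sections (reduct S)).
      { intros r Hr rho'.
        apply (sat_lift S (fun c : L0 => match c with end)). apply HS. left. now exists r. }
      rewrite <- (diagram_qfree (S := S)) by (auto; intros r Hr; apply HS; now right).
      rewrite <- (E (reduct S) HS').
      replace (fun n => s_cst S (e n)) with
        (interleave (fun _ => s_cst S (s_e M)) (fun k => s_cst S (nth k l (s_e M)))).
      - rewrite <- sat_funcst.
        + apply sat_ext. intros n Hn. now apply Hp in Hn.
        + intros c Hc. f_equal. now apply Hg.
      - apply functional_extensionality. intros n. unfold e, interleave.
        now destruct (Nat.even n). }
    destruct (classic (sat M e q)) as [H|H]; [left|right]; intros S HS rho.
    + now apply K.
    + simpl. intros H'. now apply H, (K S HS rho).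
Qed.

Theorem theorem7p7 : has_model_completion Th_LAtri.
Proof.
  exists Th_sections. split; [now intros p []|].
  split; [exact Th_sections_model_complete|].
  split; [exact Th_sections_universal | exact Th_sections_diagram_complete].
Qed.
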